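(* Let $\mathcal{H}$ be a separable infinite dimensional complex Hilbert space. Let $\mathcal{C}_{s}(\mathbb{R}_{+})$ be the space of contractive $C_{0}$-semigroups on $\mathcal{H}$, endowed with the topology of uniform weak operator convergence on compact subsets of $\mathbb{R}_{+}$. Then the set of all $T\in\mathcal{C}_{s}(\mathbb{R}_{+})$ satisfying both of the following properties is residual in $\mathcal{C}_{s}(\mathbb{R}_{+})$: (i) there exists a measurable set $A\subseteq\mathbb{R}_{+}$ of density $1$ such that $(T(t))_{t\in A}\to 0$ in the weak operator topology, as $t\to\infty$ in $A$; (ii) for each $\alpha\in\mathbb{T}$ there exists a subnet of $(T(t))_{t\in\mathbb{R}_{+}}$ that converges asymptotically (i.e. as $t\to\infty$) to $\alpha I$ in the strong operator topology.
   Context: $\mathbb{R}_{+}=[0,\infty)$, and $\mathbb{T}$ is the unit circle in the complex plane. A contractive $C_{0}$-semigroup on $\mathcal{H}$ is a strongly continuous function $T$ from $\mathbb{R}_{+}$ to the contractions on $\mathcal{H}$ (bounded operators of norm at most $1$) with $T(0)=I$ and $T(s+t)=T(s)T(t)$ for all $s,t\in\mathbb{R}_{+}$. The topology of uniform weak operator convergence on compact subsets of $\mathbb{R}_{+}$ is defined by: a net $(T_{i})_{i}$ converges to $T$ if and only if for all $\xi,\eta\in\mathcal{H}$ and all compact $K\subseteq\mathbb{R}_{+}$, $\sup_{t\in K}|\langle (T_{i}(t)-T(t))\xi,\eta\rangle|\to 0$. A measurable set $A\subseteq\mathbb{R}_{+}$ has density $1$ if $\lambda(A\cap[0,t])/\lambda([0,t])\to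 1$ as $t\to\infty$, where $\lambda$ is Lebesgue measure. In (ii), $(T(t))_{t\in\mathbb{R}_{+}}$ is viewed as a net indexed by $\mathbb{R}_{+}$ directed by $\leq$. A subset of a topological space is residual (comeagre) if it contains a countable intersection of dense open sets. *)

(* Defs.v *)
From HB Require Import structures.
From mathcomp Require Import all_boot all_order all_algebra.
From mathcomp Require Import complex.
From mathcomp Require Import all_classical all_reals all_analysis.

Set Implicit Arguments.
Unset Strict Implicit.
Unset Printing Implicit Defensive.

Import Order.TTheory GRing.Theory Num.Theory.
Import numFieldNormedType.Exports.

Local Open Scope classical_set_scope.
Local Open Scope ring_scope.
Local Open Scope complex_scope.

Definition separable (X : topologicalType) : Prop :=
  exists2 D : set X, countable D & dense D.

Definition residual (X : topologicalType) (A : set X) : Prop :=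
  exists2 U : nat -> set X,
    forall n, open (U n) /\ dense (U n) & \bigcap_n U n `<=` A.

Definition infinite_dimensional (K : fieldType) (V : lmodType K) : Prop :=
  ~ exists (n : nat) (e : 'I_n -> V),
      forall x, exists c : 'I_n -> K, x = \sum_(i < n) c i *: e i.

Definition directed (J : Type) (le : J -> J -> Prop) : Prop :=
  [/\ inhabited J, (forall j, le j j),
      (forall j k l, le j k -> le k l -> le j l) &
      (forall j k, exists2 l, le j l & le k l)].

(* A net [u : J -> X] converges to [x] iff [u @ tails le --> x]. *)
Definition tails (J : Type) (le : J -> J -> Prop) : set_system J :=
  filter_from [set: J] (fun j => [set k | le j k]).

(* [x \o h] is a subnet of a net [x] indexed by [I], in Willard's sense: [h] is
   required to be monotone as well as cofinal, which makes it a subnet in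
   Kelley's sense too. *)
Definition subnet_index (I : Type) (leI : I -> I -> Prop)
    (J : Type) (leJ : J -> J -> Prop) (h : J -> I) : Prop :=
  [/\ directed leJ, (forall j k, leJ j k -> leI (h j) (h k)) &
      (forall i, exists j, leI i (h j))].

(* An alias, because [{nonneg R}] carries no topology in the library. *)
Definition Rplus (R : realType) : Type := {nonneg R}.

HB.instance Definition _ (R : realType) :=
  Topological.copy (Rplus R)
    (initial_topology (fun t : {nonneg R} => t%:num : R)).

Definition Rplus_le (R : realType) (s t : Rplus R) : Prop :=
  s%:num <= t%:num.

Definition density_one (R : realType) (A : set R) : Prop :=
  fine (lebesgue_measure (A `&` `[0, t])) / fine (lebesgue_measure `[0, t])
    @[t --> (+oo : set_system R)] --> (1 : R).

Lemma initial_cvgP (S : choiceType) (T : topologicalType) (f : S -> T)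
   (F : set_system S) (s : S) : Filter F ->
  (F --> (s : initial_topology f)) <-> (f @ F --> f s).
Proof.
move=> FF; split=> [Fs|Ffs].
  have := @cvg_comp _ _ _ _ f F (nbhs (s : initial_topology f)) (nbhs (f s)) Fs.
  by apply; exact: initial_continuous.
move=> A; rewrite nbhsE => -[B [[C oC <-] Bs] sBA].
by apply: filterS sBA _; apply: Ffs; exact: open_nbhs_nbhs.
Qed.

Section Semigroups.
Variables (R : realType) (H : completeNormedModType R[i]).
Variable dot : {dot H for Num.conj}.

Definition contractive_operator (f : H -> H) : Prop :=
  linear f /\ forall x, `|f x| <= `|x|.

Record contractive_c0_semigroup := ContractiveC0Semigroup {
  sg :> Rplus R -> H -> H ;
  sg_contractive : forall t, contractive_operator (sg t) ;
  sg_continuous : forall x, continuous (fun t => sg t x) ;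
  sg0 : sg 0%:nng = id ;
  sgD : forall s t, sg (s%:num + t%:num)%:nng = sg s \o sg t }.

HB.instance Definition _ := gen_eqMixin contractive_c0_semigroup.
HB.instance Definition _ := gen_choiceMixin contractive_c0_semigroup.

Definition coefficients (T : contractive_c0_semigroup) :
    {ptws (H * H)%type -> {family compact, Rplus R -> R[i]^o}} :=
  fun p t => dot (T t p.1) p.2.

(* Uniform weak operator convergence on compact subsets: a product, over the
   pairs of vectors, of topologies of compact convergence. See [cvg_CsP]. *)
Definition Cs : Type := initial_topology coefficients.
HB.instance Definition _ :=
  Topological.copy Cs (initial_topology coefficients).

Lemma cvg_CsP (F : set_system Cs) (T : Cs) :
  Filter F ->
  F --> T <->
  forall (x y : H) (K : set (Rplus R)), compact K ->
    forall e : R[i], 0 < e ->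
      F [set S : Cs | forall t, K t -> `|dot (S t x - T t x) y| < e].
Proof.
move=> FF.
rewrite initial_cvgP.
pose V := {family compact, Rplus R -> R[i]^o}.
pose f := fmap coefficients F.
have Ff : Filter f by exact: fmap_filter.
rewrite -[X in X <-> _]/({ptws, f --> coefficients T}).
rewrite (@pointwise_cvgP (H * H)%type V f _ Ff).
have Fp p : Filter (fmap (fun g : {ptws (H * H)%type -> V} => g p) f).
  exact: fmap_filter.
split=> [h x y K cK e e0|h [x y]].
- move: (h (x, y)) => {h}.
  move=> /(@fam_cvgP (Rplus R) R[i]^o compact _ _ (Fp _)) /(_ _ cK) h.
  have E : nbhs (coefficients T (x, y) : {uniform` K -> R[i]^o})
      [set g : {uniform` K -> R[i]^o} |
        forall t, K t -> `|coefficients T (x, y) t - (g t : R[i])| < e].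
    rewrite uniform_nbhs.
    exists [set ab : R[i]^o * R[i]^o | `|ab.1 - ab.2| < e].
    by split; [rewrite -entourage_ballE; exists e|].
  have := h _ E; rewrite /f /=; apply: filterS => S /= hS t Kt.
  by have := hS t Kt; rewrite /coefficients /= distrC linearBl.
- apply/(@fam_cvgP (Rplus R) R[i]^o compact _ _ (Fp _)) => K cK A.
  move=> /(@uniform_nbhs (Rplus R) K R[i]^o) [E [entE sEA]].
  move: entE; rewrite -entourage_ballE => -[e /= e0 sE].
  have := h x y K cK e e0; apply: (@filterS _ F FF) => S hS.
  apply: sEA => t Kt; apply: sE; rewrite /= /ball /=.
  by have := hS t Kt; rewrite linearBl distrC.
Qed.

Definition wot_cvg (I : Type) (F : set_system I) (u : I -> H -> H)
    (f : H -> H) : Prop :=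
  forall x y, dot (u i x) y @[i --> F] --> (dot (f x) y : R[i]^o).

Definition sot_cvg (I : Type) (F : set_system I) (u : I -> H -> H)
    (f : H -> H) : Prop :=
  forall x, u i x @[i --> F] --> f x.

Definition almost_weakly_stable (T : contractive_c0_semigroup) : Prop :=
  exists A : set R, [/\ measurable A, A `<=` `[0, +oo[, density_one A &
    wot_cvg (within [set t | A t%:num] (tails (@Rplus_le R))) T (fun=> 0)].

Definition unimodular_scalar_limits (T : contractive_c0_semigroup) : Prop :=
  forall alpha : R[i], `|alpha| = 1 ->
    exists (J : Type) (leJ : J -> J -> Prop) (h : J -> Rplus R),
      subnet_index (@Rplus_le R) leJ h /\
      sot_cvg (tails leJ) (T \o h) (fun x => alpha *: x).

End Semigroups.

(* Main.v *)
Require Import Defs.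
From mathcomp Require Import all_boot all_order all_algebra.
From mathcomp Require Import complex.
From mathcomp Require Import all_classical all_reals all_analysis.
From mathcomp Require Import measurable_realfun.
From mathcomp Require Import ring lra.
Import Order.TTheory GRing.Theory Num.Theory.
Import numFieldNormedType.Exports.
Local Open Scope classical_set_scope.
Local Open Scope ring_scope.
Local Open Scope complex_scope.
Set Implicit Arguments.
Unset Strict Implicit.
Unset Printing Implicit Defensive.

(* For a complex number z and a dense sequence (x_k), the semigroups T such that
   <T(t) x_k, x_l> is 1/(n+1)-close to z <x_k, x_l> for some t >= n and all
   k, l < n form an open set. The theorem holds on the intersection of these sets
   over all n, z = 0 and z = e^(iq) with q rational:
   - since T(t) is a contraction, weak convergence of T(t) x to a x with |a| = 1
     is strong convergence, by expanding |T(t) x - a x|^2;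
   - if T(t) tends to 0 weakly along some times tending to infinity, one can choose
     t_1, ..., t_m with the T(t_i) x almost orthogonal; as T(s) is a contraction,
     sum_i |<T(s + t_i) x, y>|^2 is then bounded independently of m and s, so that
     {s | |<T(s) x, y>| >= e} has at most C of its m translates overlapping
     anywhere. Hence it has density 0, and a diagonal argument yields A.
   For density of the open sets, let C = T(delta) and let w_k be the N-th roots of
   unity. The Fejer means A_k = N^-2 sum_(p, q < N) w_k^-(p - q) C^(p - q), with
   C^-r = (C^r)^*, are positive, sum to the identity, and satisfy
   sum_k w_k^p A_k = (1 - p/N) C^p + (p/N) C^-(N - p), which is close to C^p for p
   small compared to N. Factoring the compressions of the A_k to a finite-dimensional
   subspace and using the room left in H, one obtains finitely many orthonormal
   vectors g_j and frequencies theta_j such that the unitary group rotating g_j at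
   speed theta_j is weakly close to T. A small change of the theta_j makes it equal
   to a given unimodular scalar at some large time; doubling each g_j and using two
   such scalars yields any half sum of unimodular numbers, in particular 0. *)

(** * Complex numbers and the unit circle *)

Section RealNorm.
Variable R : realType.

(** Norms over [R[i]] are themselves complex numbers; passing to the real part moves every estimate
    into [R], where [lra] and [nra] apply. *)
Definition rnorm (V : normedZmodType R[i]) (x : V) : R := complex.Re `|x|.

Section Generic.
Variable V : normedZmodType R[i].
Implicit Types x y : V.

Lemma rnormE x : (rnorm x)%:C = `|x|.
Proof. by apply: RRe_real; rewrite realE normr_ge0. Qed.

Lemma rnorm_ge0 x : 0 <= rnorm x.
Proof. by rewrite -lecR rnormE normr_ge0. Qed.

Lemma ler_rnormD x y : rnorm (x + y) <= rnorm x + rnorm y.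
Proof. by rewrite -lecR rmorphD /= !rnormE ler_normD. Qed.

Lemma rnormN x : rnorm (- x) = rnorm x.
Proof. by apply: complexI; rewrite !rnormE normrN. Qed.

Lemma rnormB x y : rnorm (x - y) = rnorm (y - x).
Proof. by apply: complexI; rewrite !rnormE distrC. Qed.

Lemma ler_rnormB x y : rnorm (x - y) <= rnorm x + rnorm y.
Proof. by rewrite -(rnormN y) ler_rnormD. Qed.

Lemma ler_rnorm_trans x y z : rnorm (x - z) <= rnorm (x - y) + rnorm (y - z).
Proof. by rewrite (_ : x - z = (x - y) + (y - z)) ?ler_rnormD// addrA subrK. Qed.

Lemma rnorm0 : rnorm (0 : V) = 0.
Proof. by rewrite /rnorm normr0. Qed.

Lemma rnorm0_eq0 x : rnorm x = 0 -> x = 0.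
Proof. by move=> x0; apply/eqP; rewrite -normr_eq0 -rnormE x0. Qed.

Lemma ler_rnorm_sum (I : Type) (r : seq I) (P : pred I) (F : I -> V) :
  rnorm (\sum_(i <- r | P i) F i) <= \sum_(i <- r | P i) rnorm (F i).
Proof.
elim/big_ind2 : _ => //; first by rewrite rnorm0.
by move=> x a y b xa yb; apply: le_trans (ler_rnormD _ _) (lerD xa yb).
Qed.

End Generic.

Lemma rnormM (a b : R[i]) : rnorm (a * b) = rnorm a * rnorm b.
Proof. by apply: complexI; rewrite rmorphM /= !rnormE normrM. Qed.

Lemma rnorm_conj (a : R[i]) : rnorm (Num.conj a) = rnorm a.
Proof. by apply: complexI; rewrite !rnormE norm_conjC. Qed.

Lemma rnorm_real (a : R) : rnorm (a%:C) = `|a|.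
Proof. by rewrite /rnorm normc_def /= expr0n addr0 sqrtr_sqr. Qed.

Lemma conj_Complex (a b : R) : Num.conj (a +i* b) = a -i* b.
Proof. by []. Qed.

Lemma Re_conj (z : R[i]) : complex.Re (Num.conj z) = complex.Re z.
Proof. by case: z. Qed.

Lemma conj_real (a : R) : Num.conj (a%:C) = a%:C.
Proof. by rewrite conj_Complex oppr0. Qed.

Lemma mul_conj (z : R[i]) : z * Num.conj z = (rnorm z ^+ 2)%:C.
Proof. by rewrite -normCK rmorphXn /= rnormE. Qed.

Lemma Re_le_rnorm (z : R[i]) : `|complex.Re z| <= rnorm z.
Proof. by rewrite -lecR rnormE normc_ge_Re. Qed.

Lemma ReM_real (a : R) (z : R[i]) : complex.Re (a%:C * z) = a * complex.Re z.
Proof. by case: z => x y /=; rewrite mul0r subr0. Qed.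

Lemma ge0_Re (z : R[i]) : Num.conj z = z -> 0 <= complex.Re z -> 0 <= z.
Proof.
case: z => a b; rewrite conj_Complex => -[] nb /= a0.
by rewrite lecE /= a0 andbT; apply/eqP; lra.
Qed.

Lemma gt0_complexE (e : R[i]) : 0 < e -> exists2 r : R, 0 < r & e = r%:C.
Proof.
move=> e0; exists (complex.Re e); last by rewrite RRe_real // gtr0_real.
by move: e0; rewrite ltcE /= => /andP[].
Qed.

Lemma rnorm_lt (V : normedZmodType R[i]) (x : V) (e : R) :
  (`|x| < e%:C) = (rnorm x < e).
Proof. by rewrite -rnormE ltcR. Qed.

End RealNorm.

Section UnitCircle.
Variable R : realType.
Implicit Types a b : R.

Definition ei (a : R) : R[i] := cos a +i* sin a.

Lemma ei0 : ei 0 = 1.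
Proof. by rewrite /ei cos0 sin0. Qed.

Lemma eiD a b : ei (a + b) = ei a * ei b.
Proof.
rewrite /ei cosD sinD; apply/eqP; rewrite eq_complex /=.
by apply/andP; split; apply/eqP; ring.
Qed.

Lemma conj_ei a : Num.conj (ei a) = ei (- a).
Proof. by rewrite conj_Complex /ei cosN sinN. Qed.

Lemma ei_mul_conj a : ei a * Num.conj (ei a) = 1.
Proof. by rewrite conj_ei -eiD subrr ei0. Qed.

Lemma rnorm_ei a : rnorm (ei a) = 1.
Proof.
have : (rnorm (ei a)) ^+ 2 = 1 ^+ 2.
  by apply: complexI; rewrite -mul_conj ei_mul_conj expr1n.
by move/eqP; rewrite eqrXn2 ?rnorm_ge0// => /eqP.
Qed.

Lemma ei_exp a n : ei a ^+ n = ei (n%:R * a).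
Proof.
elim: n => [|n IH]; first by rewrite expr0 mul0r ei0.
by rewrite exprS IH -eiD -[in RHS]addn1 natrD mulrDl mul1r addrC.
Qed.

Lemma ei2pi : ei (pi *+ 2) = 1.
Proof. by rewrite /ei cos2pi sin2pi. Qed.

Lemma ei2piM (n : int) : ei (n%:~R * (pi *+ 2)) = 1.
Proof.
case: n => n; first by rewrite -ei_exp ei2pi expr1n.
rewrite NegzE mulrNz mulNr -conj_ei -ei_exp ei2pi expr1n.
by rewrite rmorph1.
Qed.

Lemma rnorm_ei_sub1_sqr a : rnorm (ei a - 1) ^+ 2 = 2 - 2 * cos a.
Proof.
apply: complexI; rewrite -mul_conj rmorphB /= rmorph1 mulrBr mulrBl.
rewrite ei_mul_conj !mul1r mulr1 /ei.
apply/eqP; rewrite eq_complex /=; apply/andP; split; apply/eqP; ring.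
Qed.

Lemma ei_ne1 a : 0 < a < pi *+ 2 -> ei a != 1.
Proof.
move=> /andP[a0 a2]; apply/eqP => /(congr1 (@complex.Re R)) /=.
have -> : a = (a / 2) *+ 2 by rewrite mulr2n; lra.
rewrite cos_mulr2n cos2sin2.
have : 0 < sin (a / 2) by apply: sin_gt0_pi; rewrite mulr2n in a2; lra.
by rewrite mulr2n; nra.
Qed.

Lemma unit_circleP (z : R[i]) : rnorm z = 1 -> exists a, z = ei a.
Proof.
case: z => x y z1.
have /esym : rnorm (x +i* y) ^+ 2 = x ^+ 2 + y ^+ 2.
  by apply: complexI; rewrite (add_Re2_Im2 (x +i* y)) rmorphXn /= rnormE.
rewrite z1 expr1n => xy.
have x1 : -1 <= x <= 1 by apply/andP; split; nra.
have s2 : Num.sqrt (1 - x ^+ 2) = `|y|.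
  by rewrite -xy addrAC subrr add0r sqrtr_sqr.
have [y0|y0] := leP 0 y.
  exists (acos x); rewrite /ei acosK ?in_itv//= sin_acos// s2 ger0_norm//.
exists (- acos x); rewrite /ei cosN sinN acosK ?in_itv//= sin_acos// s2.
by rewrite ltr0_norm// opprK.
Qed.

Lemma ei_near0 (e : R) : 0 < e ->
  exists2 d : R, 0 < d & forall a, `|a| < d -> rnorm (ei a - 1) < e.
Proof.
move=> e0.
have c0 : {for 0, continuous (@cos R)} by exact: continuous_cos.
(* Since |e^(ia) - 1|^2 = 2 (1 - cos a), it is enough that 1 - cos a < e^2 / 2. *)
have /cvgrPdist_lt/(_ (e ^+ 2 / 2)) := c0.
move=> /(_ _)[|d /= d0 hd]; first by nra.
exists d => // a ad.
have := hd a; rewrite /= sub0r normrN => /(_ ad); rewrite cos0 => ha.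
have := rnorm_ge0 (ei a - 1); have := rnorm_ei_sub1_sqr a.
have := ler_norm (1 - cos a).
by move=> ?; nra.
Qed.

Lemma rnorm_ei_sub a b : rnorm (ei a - ei b) = rnorm (ei (a - b) - 1).
Proof.
have -> : ei a - ei b = (ei (a - b) - 1) * ei b.
  by rewrite mulrBl -eiD subrK mul1r.
by rewrite rnormM rnorm_ei mulr1.
Qed.

Lemma continuous_ei : continuous (ei : R -> R[i]^o).
Proof.
move=> a; apply/cvgrPdist_lt => _/gt0_complexE[e e0 ->].
have [d d0 hd] := ei_near0 e0.
exists d => //= b ab; rewrite rnorm_lt rnorm_ei_sub; exact: hd.
Qed.

(** The square of the norm is 2 - 2 cos a, and [cos] is even and decreasing on [[0, pi]]. This later
    controls the diagonal groups inside one sampling step. *)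
Lemma rnorm_ei_sub1_le a b : `|a| <= `|b| -> `|b| <= pi ->
  rnorm (ei a - 1) <= rnorm (ei b - 1).
Proof.
move=> ab bpi.
have : rnorm (ei a - 1) ^+ 2 <= rnorm (ei b - 1) ^+ 2.
  rewrite !rnorm_ei_sub1_sqr -(cos_norm a) -(cos_norm b).
  suff : cos `|b| <= cos `|a| by lra.
  have := normr_ge0 a; have := normr_ge0 b => b0 a0.
  move: ab; rewrite le_eqVlt => /orP[/eqP->//|ab].
  by apply: ltW; rewrite ltr_cos ?in_itv/=; lra.
by rewrite ler_sqr ?nnegrE ?rnorm_ge0.
Qed.

End UnitCircle.

(** * Orthonormal systems *)

Section Hilbert.
Variables (R : realType) (H : completeNormedModType R[i]).
Variable dot : {dot H for Num.conj}.
Hypothesis dot_norm : forall x : H, dot x x = `|x| ^+ 2.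

Lemma dotC x y : dot x y = Num.conj (dot y x).
Proof. by rewrite hermC expr0 mul1r. Qed.

Lemma dotDl x y z : dot (x + y) z = dot x z + dot y z.
Proof. exact: linearDl. Qed.

Lemma dotDr x y z : dot x (y + z) = dot x y + dot x z.
Proof. exact: linearDr. Qed.

Lemma dotBl x y z : dot (x - y) z = dot x z - dot y z.
Proof. exact: linearBl. Qed.

Lemma dotBr x y z : dot x (y - z) = dot x y - dot x z.
Proof. exact: linearBr. Qed.

Lemma dotZl a x y : dot (a *: x) y = a * dot x y.
Proof. exact: linearZl_LR. Qed.

Lemma dotZr a x y : dot x (a *: y) = Num.conj a * dot x y.
Proof. exact: linearZr_LR. Qed.

Lemma dot0l x : dot 0 x = 0.
Proof. exact: linear0l. Qed.

Lemma dot0r x : dot x 0 = 0.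
Proof. exact: linear0r. Qed.

Lemma dot_suml (I : Type) (r : seq I) (P : pred I) (F : I -> H) y :
  dot (\sum_(i <- r | P i) F i) y = \sum_(i <- r | P i) dot (F i) y.
Proof. exact: linear_sumlz. Qed.

Lemma dot_sumr (I : Type) (r : seq I) (P : pred I) (F : I -> H) y :
  dot y (\sum_(i <- r | P i) F i) = \sum_(i <- r | P i) dot y (F i).
Proof. exact: linear_sumr. Qed.

Lemma dot_rnorm x : dot x x = (rnorm x ^+ 2)%:C.
Proof. by rewrite dot_norm rmorphXn /= rnormE. Qed.

Lemma rnorm_sqr x : rnorm x ^+ 2 = complex.Re (dot x x).
Proof. by rewrite dot_rnorm. Qed.

Lemma rnormZ (a : R[i]) (x : H) : rnorm (a *: x) = rnorm a * rnorm x.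
Proof. by apply: complexI; rewrite rmorphM /= !rnormE normrZ. Qed.

Lemma rnorm_sqrD x y :
  rnorm (x + y) ^+ 2 = rnorm x ^+ 2 + 2 * complex.Re (dot x y) + rnorm y ^+ 2.
Proof.
rewrite !rnorm_sqr dotDl !dotDr (dotC y x) !raddfD /= Re_conj.
by ring.
Qed.

Lemma rnorm_sqrB x y :
  rnorm (x - y) ^+ 2 = rnorm x ^+ 2 - 2 * complex.Re (dot x y) + rnorm y ^+ 2.
Proof.
rewrite rnorm_sqrD rnormN (_ : dot x (- y) = - dot x y); last exact: linearNr.
by rewrite raddfN /=; ring.
Qed.

Lemma cauchy_schwarz x y : rnorm (dot x y) <= rnorm x * rnorm y.
Proof.
have [/rnorm0_eq0->|y0] := eqVneq (rnorm y) 0.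
  by rewrite dot0r !rnorm0 mulr0.
have y1 : 0 < rnorm y by rewrite lt_neqAle eq_sym y0 rnorm_ge0.
have x0 := rnorm_ge0 x; have d0 := rnorm_ge0 (dot x y).
set n := rnorm y in y0 y1 *; set d := rnorm _ in d0 *.
(* The vector [c *: y] is the orthogonal projection of [x] on [y]; the inequality says that the
   squared norm of [x - c *: y] is nonnegative. *)
pose c := ((n ^+ 2)^-1)%:C * dot x y.
have : rnorm (x - c *: y) ^+ 2 = rnorm x ^+ 2 - d ^+ 2 / n ^+ 2.
  rewrite rnorm_sqrB dotZr rmorphM /= conj_real -mulrA ReM_real.
  rewrite [Num.conj _ * _]mulrC mul_conj /= -/d rnormZ rnormM rnorm_real -/d -/n.
  rewrite ger0_norm ?invr_ge0 ?sqr_ge0//.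
  by field.
move=> E; have := sqr_ge0 (rnorm (x - c *: y)); rewrite E subr_ge0.
rewrite ler_pdivrMr ?exprn_gt0// -exprMn ler_sqr// nnegrE//.
by rewrite mulr_ge0// ltW.
Qed.

End Hilbert.

Section Orthonormal.
Variables (R : realType) (H : completeNormedModType R[i]).
Variable dot : {dot H for Num.conj}.
Hypothesis dot_norm : forall x : H, dot x x = `|x| ^+ 2.

Definition onseq (s : seq H) := forall i j, (i < size s)%N -> (j < size s)%N ->
  dot s`_i s`_j = (i == j)%:R.

Definition proj (s : seq H) (x : H) : H := \sum_(v <- s) dot x v *: v.

Lemma proj_ord s x : proj s x = \sum_(i < size s) dot x s`_i *: s`_i.
Proof. by rewrite /proj (big_nth 0) big_mkord. Qed.

Lemma dot_proj s x i : onseq s -> (i < size s)%N ->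
  dot (proj s x) s`_i = dot x s`_i.
Proof.
move=> os si; rewrite proj_ord dot_suml (bigD1 (Ordinal si)) //= dotZl os//.
rewrite eqxx mulr1 big1 ?addr0// => j ji; rewrite dotZl os//.
rewrite (_ : (j == i :> nat) = false) ?mulr0//; apply/negbTE.
by apply: contraNneq ji => ji; apply/eqP/val_inj.
Qed.

Lemma onseq_rcons s v : onseq s -> dot v v = 1 ->
  (forall i, (i < size s)%N -> dot v s`_i = 0) -> onseq (rcons s v).
Proof.
move=> os vv vs i j; rewrite size_rcons !ltnS => si sj.
rewrite (nth_rcons 0 s v i) (nth_rcons 0 s v j).
rewrite leq_eqVlt in si; rewrite leq_eqVlt in sj.
case/predU1P: si => [->|si]; case/predU1P: sj => [->|sj].
- by rewrite ltnn !eqxx.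
- by rewrite ltnn eqxx sj vs// gtn_eqF.
- by rewrite ltnn eqxx si (dotC _ _ v) vs// rmorph0 ltn_eqF.
- by rewrite si sj os.
Qed.

(** Gram-Schmidt step: [v] is [x - proj s x] normalised. Being in the span of [s] is expressed as
    being fixed by [proj s], and the last clause says that the span grows. *)
Lemma onseq_extend s x : onseq s -> proj s x <> x ->
  exists v, [/\ onseq (rcons s v), proj (rcons s v) x = x &
    forall y, proj s y = y -> proj (rcons s v) y = y].
Proof.
move=> os sx; pose w := x - proj s x; pose n := rnorm w.
have w0 : w != 0 by apply/eqP => /eqP; rewrite subr_eq0 eq_sym => /eqP.
have n0 : n != 0.
  by apply: contra_neq w0 => ?; exact: rnorm0_eq0.
have ws i : (i < size s)%N -> dot w s`_i = 0.
  by move=> si; rewrite /w dotBl dot_proj// subrr.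
have wp y : dot (proj s y) w = 0.
  rewrite proj_ord dot_suml big1// => i _.
  by rewrite dotZl (dotC _ _ w) ws// rmorph0 mulr0.
pose v := (n^-1)%:C *: w.
have rc y : proj (rcons s v) y = proj s y + dot y v *: v.
  by rewrite /proj -cats1 big_cat /= big_seq1.
exists v; split.
- apply: onseq_rcons => //; last by move=> i si; rewrite /v dotZl ws// mulr0.
  rewrite /v dotZl dotZr conj_real (dot_rnorm dot_norm) -/n -!rmorphM /=.
  by rewrite (_ : _ * _ = 1)//; field.
- rewrite rc (_ : dot x v = n%:C).
    rewrite /v scalerA -rmorphM /= mulfV// scale1r /w addrC subrK//.
  rewrite -[X in dot X _](subrK (proj s x)) dotDl -/w /v !dotZr wp mulr0 addr0.
  rewrite conj_real (dot_rnorm dot_norm) -/n -!rmorphM /=.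
  by congr (_%:C); field.
- by move=> y sy; rewrite rc -[in dot y v]sy /v dotZr wp mulr0 scale0r addr0.
Qed.

Lemma gram_schmidt (l : seq H) :
  exists2 s, onseq s & forall x, x \in l -> proj s x = x.
Proof.
elim: l => [|x l [s os sl]]; first by exists [::].
have [sx|sx] := pselect (proj s x = x).
  by exists s => // y; rewrite inE => /predU1P[->//|/sl].
have [v [ov vx vy]] := onseq_extend os sx.
by exists (rcons s v) => // y; rewrite inE => /predU1P[->//|/sl/vy].
Qed.

(** In infinite dimension no finite orthonormal system spans, so some [x] is moved by the projection
    and [onseq_extend] applies. *)
Lemma onseq_pad s n : infinite_dimensional H -> onseq s ->
  exists2 t, size t = n & onseq (s ++ t).
Proof.
move=> infH os; elim: n => [|n [t tn ot]]; first by exists [::]; rewrite ?cats0.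
have [x xst] : exists x, proj (s ++ t) x <> x.
  apply: contrapT => /forallNP K; apply: infH.
  exists (size (s ++ t)), (fun i => (s ++ t)`_i) => x.
  exists (fun i => dot x (s ++ t)`_i).
  by rewrite -proj_ord; apply/esym; apply: contrapT; exact: K.
have [v [ov _ _]] := onseq_extend ot xst.
by exists (rcons t v); rewrite ?size_rcons ?tn// -rcons_cat.
Qed.

Definition onfam (I : finType) (g : I -> H) :=
  forall i j, dot (g i) (g j) = (i == j)%:R.

(* Both [s] and [e i = \sum_j b i j *: f j] are orthonormal and [s] is orthogonal
   to [f]; the product [w] of the reflections along the [s`_i - e i] maps [e] to
   [s], hence [g = w \o f] works. *)
Lemma onseq_realize (I : finType) (s : seq H) (b : 'I_(size s) -> I -> R[i]) :
  infinite_dimensional H -> onseq s ->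
  (forall i k, \sum_j b i j * Num.conj (b k j) = (i == k)%:R) ->
  exists2 g : I -> H, onfam g & forall i : 'I_(size s), s`_i = \sum_j b i j *: g j.
Proof.
move=> infH os bb; have [t tI ost] := onseq_pad #|I| infH os.
have szst : size (s ++ t) = (size s + #|I|)%N by rewrite size_cat tI.
pose f (j : I) := t`_(enum_rank j).
have ff : onfam f.
  move=> i j.
  have := ost (size s + enum_rank i)%N (size s + enum_rank j)%N.
  rewrite szst !ltn_add2l !ltn_ord => /(_ isT isT).
  rewrite !nth_cat !(ltnNge (size s + _)) !leq_addr !addKn => ->.
  by rewrite eqn_add2l val_eqE (inj_eq enum_rank_inj).
have sf (i : 'I_(size s)) j : dot s`_i (f j) = 0.
  have := ost i (size s + enum_rank j)%N.
  rewrite szst ltn_add2l ltn_ord ltn_addr// => /(_ isT isT).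
  rewrite ltn_eqF ?ltn_addr//.
  by rewrite (nth_cat 0 s t i) ltn_ord nth_cat ltnNge leq_addr addKn.
pose e i := \sum_j b i j *: f j.
have se i k : dot s`_(i : 'I_(size s)) (e k) = 0.
  by rewrite dot_sumr big1// => j _; rewrite dotZr sf mulr0.
have ef i j : dot (e i) (f j) = b i j.
  rewrite dot_suml (bigD1 j)//= dotZl ff eqxx mulr1 big1 ?addr0// => k kj.
  by rewrite dotZl ff (negbTE kj) mulr0.
have ee i k : dot (e i) (e k) = (i == k)%:R.
  rewrite [in X in dot _ X]/e dot_sumr -bb; apply: eq_bigr => j _.
  by rewrite dotZr ef mulrC.
pose u i := s`_(i : 'I_(size s)) - e i.
have uu i k : dot (u i) (u k) = (i == k)%:R *+ 2.
  rewrite /u dotBl !dotBr se ee (dotC _ (e i)) se rmorph0 subr0 sub0r opprK os//.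
(* The [u i] are orthogonal with squared norm 2, which is why the reflection coefficient 2 <x, u> /
   |u|^2 is just <x, u>. *)
pose w x := x - \sum_i dot x (u i) *: u i.
have wu x k : dot (w x) (u k) = - dot x (u k).
  rewrite /w dotBl dot_suml (bigD1 k)//= dotZl uu eqxx big1 ?addr0.
    by rewrite mulr2n -[true%:R]/(1 : R[i]); ring.
  by move=> i ik; rewrite dotZl uu (negbTE ik) mul0rn mulr0.
have ww x y : dot (w x) (w y) = dot x y.
  rewrite [in X in dot _ X]/w dotBr dot_sumr [in X in X - _]/w dotBl dot_suml.
  rewrite -addrA -opprD -big_split /= big1 ?subr0// => i _.
  by rewrite dotZl dotZr wu (dotC _ (u i)); ring.
have wZ a x : w (a *: x) = a *: w x.
  rewrite /w scalerBr scaler_sumr; congr (_ - _); apply: eq_bigr => i _.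
  by rewrite dotZl scalerA.
have wD x y : w (x + y) = w x + w y.
  rewrite /w addrACA -opprD -big_split /=; congr (_ - _).
  by apply: eq_bigr => i _; rewrite dotDl scalerDl.
have w0 : w 0 = 0 by rewrite -(scale0r 0) wZ !scale0r.
have we i : w (e i) = s`_i.
  rewrite /w (bigD1 i)//= big1 ?addr0.
    rewrite /u dotBr ee (dotC _ (e i)) se rmorph0 eqxx sub0r scaleN1r opprK.
    by rewrite addrC subrK.
  move=> k ki; rewrite /u dotBr ee (dotC _ (e i)) se rmorph0 eq_sym (negbTE ki) subr0.
  by rewrite scale0r.
exists (w \o f); first by move=> i j; rewrite /= ww ff.
move=> i; rewrite -we /e (big_morph w wD w0).
by apply: eq_bigr => j _; rewrite wZ.
Qed.

End Orthonormal.

(** * Diagonal unitary groups *)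

Section DiagonalSemigroup.
Variables (R : realType) (H : completeNormedModType R[i]).
Variable dot : {dot H for Num.conj}.
Hypothesis dot_norm : forall x : H, dot x x = `|x| ^+ 2.
Variables (I : finType) (g : I -> H) (theta : I -> R).
Hypothesis g_on : onfam dot g.

(** Written as a finite-rank perturbation of the identity, so that the group acts trivially on the
    orthogonal complement of the [g j] and no basis of that complement is needed. *)
Definition diag_fun (t : R) (x : H) : H :=
  x + \sum_j ((ei (theta j * t) - 1) * dot x (g j)) *: g j.

Lemma dot_diag t x j : dot (diag_fun t x) (g j) = ei (theta j * t) * dot x (g j).
Proof.
rewrite /diag_fun dotDl dot_suml (bigD1 j)//= dotZl g_on eqxx big1.
  by rewrite -[true%:R]/(1 : R[i]); ring.
by move=> k kj; rewrite dotZl g_on (negbTE kj) mulr0.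
Qed.

Lemma diag_linear t : linear (diag_fun t).
Proof.
move=> a x y; rewrite /diag_fun scalerDr addrACA; congr (_ + _).
rewrite scaler_sumr -big_split /=; apply: eq_bigr => j _.
by rewrite dotDl dotZl scalerA -scalerDl; congr (_ *: _); ring.
Qed.

Lemma diag_isometry t x : rnorm (diag_fun t x) = rnorm x.
Proof.
have : dot (diag_fun t x) (diag_fun t x) = dot x x.
  rewrite [in X in dot _ X]/diag_fun dotDr dot_sumr.
  under eq_bigr do rewrite dotZr dot_diag.
  rewrite /diag_fun dotDl dot_suml -addrA -big_split /= big1 ?addr0// => j _.
  rewrite dotZl rmorphM rmorphB /= rmorph1 (dotC _ (g j)).
  set e := ei _; set d := dot _ _.
  rewrite (_ : (Num.conj e - 1) * Num.conj d * (e * d) =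
    (e * Num.conj e - e) * (d * Num.conj d)); last by ring.
  by rewrite ei_mul_conj; ring.
rewrite !(dot_rnorm dot_norm) => /complexI/eqP.
by rewrite eqrXn2 ?rnorm_ge0// => /eqP.
Qed.

Lemma diag0 : diag_fun 0 = id.
Proof.
apply/funext => x; rewrite /diag_fun big1 ?addr0// => j _.
by rewrite mulr0 ei0 subrr mul0r scale0r.
Qed.

Lemma diagD s t : diag_fun (s + t) = diag_fun s \o diag_fun t.
Proof.
apply/funext => x /=; rewrite [diag_fun s _]/diag_fun.
under [in RHS]eq_bigr do rewrite dot_diag.
rewrite {2}/diag_fun -addrA -big_split /= /diag_fun; congr (_ + _).
apply: eq_bigr => j _; rewrite -scalerDl mulrDr eiD; congr (_ *: _); ring.
Qed.

Lemma diag_continuous x : continuous (diag_fun^~ x).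
Proof.
rewrite /diag_fun => t; apply: cvgD; first exact: cvg_cst.
apply: cvg_big => [|j _]; first exact: add_continuous.
apply: cvgZr_tmp.
have ce : ei (theta j * r) @[r --> t] --> (ei (theta j * t) : R[i]^o).
  apply: (@continuous_comp R R R[i]^o _ (@ei R)); last exact: continuous_ei.
  exact: mulrl_continuous.
have c1 := @cvgB R[i] R[i]^o R (nbhs t) _ _ _ _ _ ce (cvg_cst (1 : R[i]^o)).
exact: (@cvgMr_tmp R[i] R (nbhs t) _ _ _ (dot x (g j)) (c1 _ _)).
Qed.

Definition diag_sg_fun (t : Rplus R) (x : H) : H := diag_fun t%:num x.

Lemma diag_sg_contractive t : contractive_operator (diag_sg_fun t).
Proof.
split; first exact: diag_linear.
by move=> x; rewrite -!rnormE lecR diag_isometry.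
Qed.

Lemma diag_sg_continuous x : continuous (fun t => diag_sg_fun t x).
Proof.
move=> t; apply: (@continuous_comp (Rplus R) R H _ (diag_fun^~ x)).
  exact: initial_continuous.
exact: diag_continuous.
Qed.

Lemma diag_sg0 : diag_sg_fun 0%:nng = id.
Proof. exact: diag0. Qed.

Lemma diag_sgD s t :
  diag_sg_fun (s%:num + t%:num)%:nng = diag_sg_fun s \o diag_sg_fun t.
Proof. exact: diagD. Qed.

Definition diag_sg : contractive_c0_semigroup H :=
  ContractiveC0Semigroup diag_sg_contractive diag_sg_continuous
    diag_sg0 diag_sgD.

(** On the span of [g] the identity part is absorbed, and estimates on the group reduce to estimates
    on finite exponential sums. *)
Lemma diag_coef t x y : x = \sum_j dot x (g j) *: g j ->
  dot (diag_fun t x) y =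
  \sum_j ei (theta j * t) * (dot x (g j) * Num.conj (dot y (g j))).
Proof.
move=> xg; rewrite /diag_fun [X in X + _]xg -big_split dot_suml /=.
apply: eq_bigr => j _; rewrite -scalerDl dotZl (dotC _ y).
by rewrite Num.Theory.conjCK; ring.
Qed.

End DiagonalSemigroup.

(** * Factorisation of positive semidefinite matrices *)

Section PositiveMatrix.
Local Open Scope sesquilinear_scope.
Variable R : realType.

(** The spectral theorem diagonalises [A] by a unitary [P]; [B] is the adjoint of [P] times the
    square root of the diagonal part. *)
Lemma psd_factor n (A : 'M[R[i]]_n) :
  (forall i j, A i j = Num.conj (A j i)) ->
  (forall v : 'rV_n, 0 <= (v *m A *m v ^t* ) 0 0) ->
  exists B : 'M[R[i]]_n, A = B *m B ^t* .
Proof.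
move=> Aherm Apos.
have /hermitian_normalmx/orthomx_spectralP Aspec : A \is hermsymmx.
  apply/is_hermitianmxP; rewrite expr0 scale1r; apply/matrixP => i j.
  by rewrite !mxE.
have := spectral_unitarymx A; set P := spectralmx A => Punit.
set sp := spectral_diag A in Aspec *.
rewrite (invmx_unitary Punit) -/P in Aspec.
have PP : P *m P ^t* = 1%:M by exact/unitarymxP.
clearbody P sp.
(* The value of the quadratic form at the [i]-th row of [P] is the [i]-th eigenvalue. *)
have sp0 i : 0 <= sp 0 i.
  have := Apos (row i P); rewrite {1}Aspec !mulmxA.
  rewrite -[row i P *m P ^t*]row_mul PP row1 -!mulmxA.
  rewrite (_ : P *m (row i P) ^t* = delta_mx i 0); last first.
    rewrite -(trmxK (_ *m _)); apply/matrixP => a b; rewrite !mxE.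
    have := congr1 (fun M : 'M[R[i]]_n => M a i) PP; rewrite !mxE => E.
    rewrite ord1 eqxx andbT -E; apply: eq_bigr => k _.
    by rewrite !mxE.
  by rewrite -rowE -colE !mxE eqxx mulr1n.
pose D := diag_mx (map_mx sqrtC sp).
have DD : D *m D ^t* = diag_mx sp.
  rewrite /D tr_diag_mx map_diag_mx mulmx_diag; congr diag_mx.
  apply/matrixP => a b; rewrite !mxE ord1 -[RHS]sqrtCK expr2.
  by congr (_ * _); apply/CrealP; rewrite ger0_real ?sqrtC_ge0.
exists (P ^t* *m D).
by rewrite trmx_mul map_mxM trmxCK mulmxA -(mulmxA _ D) DD.
Qed.

End PositiveMatrix.

(** * Positive Fejer forms of a contraction *)

Section FejerForm.
Variables (R : realType) (H : completeNormedModType R[i]).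
Variable dot : {dot H for Num.conj}.
Hypothesis dot_norm : forall x : H, dot x x = `|x| ^+ 2.

Lemma linear_at0 (C : H -> H) : linear C -> C 0 = 0.
Proof.
move=> linC; have := linC (-1) 0 0.
by rewrite scaler0 addr0 scaleN1r addNr.
Qed.

(* With [y n = \sum_(r < n) C^r x] one has [y n.+1 = x + C (y n)], so that
   [|y n.+1|^2 <= 2 Re <y n.+1, x> - |x|^2 + |y n|^2]; sum over [n]. *)
Lemma fejer_ge0 (C : H -> H) N x :
  linear C -> (forall y, rnorm (C y) <= rnorm y) ->
  0 <= 2 * complex.Re (\sum_(r < N) (N - r)%:R * dot (iter r C x) x)
       - N%:R * rnorm x ^+ 2.
Proof.
move=> linC contrC; pose y n := \sum_(r < n) iter r C x.
have C0 := linear_at0 linC.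
have CD u v : C (u + v) = C u + C v by rewrite -[u in LHS]scale1r linC scale1r.
have yS n : y n.+1 = x + C (y n).
  by rewrite /y big_ord_recl (big_morph C CD C0).
set S := fun N => \sum_(r < N) (N - r)%:R * dot (iter r C x) x.
rewrite -/(S N); suff : rnorm (y N) ^+ 2 <= 2 * complex.Re (S N) - N%:R * rnorm x ^+ 2.
  by apply: le_trans; exact: sqr_ge0.
have SS n : S n.+1 = S n + dot (y n.+1) x.
  rewrite /S /y dot_suml [in LHS]big_ord_recr /= subSnn mul1r.
  rewrite [in RHS]big_ord_recr /= addrA -big_split /=; congr (_ + _).
  apply: eq_bigr => r _; rewrite subSn ?(ltnW (ltn_ord r))//.
  by rewrite -natr1 mulrDl mul1r.
elim: N => [|n IH].
  by rewrite /y /S !big_ord0 rnorm0 /=; lra.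
have := contrC (y n); have := rnorm_ge0 (C (y n)); have := rnorm_ge0 (y n).
have := rnorm_sqrD dot_norm x (C (y n)); rewrite -yS.
have : complex.Re (dot (y n.+1) x) = rnorm x ^+ 2 + complex.Re (dot x (C (y n))).
  rewrite yS dotDl raddfD /= (dotC _ (C _)) Re_conj.
  by rewrite (rnorm_sqr dot_norm).
rewrite SS raddfD /= -natr1.
by move=> -> -> *; nra.
Qed.

Lemma iter_linear (C : H -> H) r : linear C -> linear (iter r C).
Proof.
move=> linC; elim: r => [|r IH] a x y //=.
by rewrite IH linC.
Qed.

(** Apply [fejer_ge0] to [w *: C], again a linear contraction. *)
Lemma fejer_twist_ge0 (C : H -> H) N x (w : R[i]) :
  linear C -> (forall y, rnorm (C y) <= rnorm y) -> rnorm w = 1 ->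
  0 <= 2 * complex.Re (\sum_(r < N) (N - r)%:R * w ^+ r * dot (iter r C x) x)
       - N%:R * rnorm x ^+ 2.
Proof.
move=> linC contrC w1; pose C' y := w *: C y.
have linC' : linear C'.
  move=> a u v; rewrite /C' linC scalerDr !scalerA.
  by rewrite (mulrC w a).
have iC r : iter r C' x = w ^+ r *: iter r C x.
  elim: r => [|r IH]; first by rewrite scale1r.
  have CZ u : C (w ^+ r *: u) = w ^+ r *: C u.
    have C0 := linear_at0 linC.
    by rewrite -[_ *: u]addr0 linC C0 addr0.
  by rewrite /= IH /C' CZ scalerA exprS.
have := @fejer_ge0 C' N x linC'.
rewrite (eq_bigr (fun r => (N - (r : 'I_N))%:R * w ^+ r * dot (iter r C x) x)).
  by apply=> y; rewrite rnormZ w1 mul1r.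
by move=> r _; rewrite iC dotZl mulrA.
Qed.

Section Form.
Variables (C : H -> H) (N : nat).
Hypotheses (linC : linear C) (contrC : forall y, rnorm (C y) <= rnorm y).

(* [fejer_form] is the double sum of [w^-(p - q) <C^(p - q) x, y>] over [p, q < N],
   divided by [N^2]: the difference [r = p - q] occurs [N - r] times. *)
Definition half_form (w : R[i]) x y :=
  \sum_(r < N) (N - r)%:R * Num.conj w ^+ r * dot (iter r C x) y.

Definition fejer_form w x y := N%:R ^- 2 *
  (half_form w x y + Num.conj (half_form w y x) - N%:R * dot x y).

Lemma half_form_linear w y a x x' :
  half_form w (a *: x + x') y = a * half_form w x y + half_form w x' y.
Proof.
rewrite /half_form mulr_sumr -big_split; apply: eq_bigr => r _ /=.
by rewrite (iter_linear _ linC) dotDl dotZl; ring.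
Qed.

Lemma half_form_conj w x a y y' :
  half_form w x (a *: y + y') = Num.conj a * half_form w x y + half_form w x y'.
Proof.
rewrite /half_form mulr_sumr -big_split; apply: eq_bigr => r _ /=.
by rewrite dotDr dotZr; ring.
Qed.

Lemma fejer_formC w x y : fejer_form w x y = Num.conj (fejer_form w y x).
Proof.
rewrite /fejer_form rmorphM rmorphB rmorphD /= rmorphM /=.
rewrite Num.Theory.conjCK -(dotC _ x y) fmorphV rmorphXn /= !rmorph_nat.
by congr (_ * (_ - _)); exact: addrC.
Qed.

Lemma fejer_form_linear w y a x x' :
  fejer_form w (a *: x + x') y = a * fejer_form w x y + fejer_form w x' y.
Proof.
rewrite /fejer_form half_form_linear half_form_conj dotDl dotZl.
by rewrite rmorphD rmorphM /= Num.Theory.conjCK; ring.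
Qed.

Lemma fejer_form_suml (I : finType) (c : I -> R[i]) (u : I -> H) w y :
  fejer_form w (\sum_i c i *: u i) y = \sum_i c i * fejer_form w (u i) y.
Proof.
have f0 : fejer_form w 0 y = 0.
  have := fejer_form_linear w y (-1) 0 0; rewrite scaleN1r addNr => ->.
  by rewrite mulN1r addNr.
have fD u1 u2 : fejer_form w (u1 + u2) y = fejer_form w u1 y + fejer_form w u2 y.
  by rewrite -[u1 in LHS]scale1r fejer_form_linear mul1r.
rewrite (big_morph (fun z => fejer_form w z y) fD f0); apply: eq_bigr => i _.
by rewrite -[_ *: _]addr0 fejer_form_linear f0 addr0.
Qed.

Lemma fejer_form_sumr (I : finType) (c : I -> R[i]) (u : I -> H) w y :
  fejer_form w y (\sum_i c i *: u i) = \sum_i Num.conj (c i) * fejer_form w y (u i).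
Proof.
rewrite fejer_formC fejer_form_suml rmorph_sum /=; apply: eq_bigr => i _.
by rewrite rmorphM /= -fejer_formC.
Qed.

(** Hermitian symmetry makes the value real, and N^2 times it is 2 Re (half form) - N |x|^2, the
    quantity of [fejer_twist_ge0] for the conjugate of [w]. *)
Lemma fejer_form_ge0 w x : rnorm w = 1 -> 0 <= fejer_form w x x.
Proof.
move=> w1; apply: ge0_Re; first by rewrite -fejer_formC.
have := @fejer_twist_ge0 C N x (Num.conj w) linC contrC.
rewrite rnorm_conj -/(half_form w x x) => /(_ w1) h.
rewrite /fejer_form -(rmorph_nat (@real_complex_def R (Phant R))).
rewrite -rmorphXn -fmorphV ReM_real mulr_ge0 ?invr_ge0 ?exprn_ge0//.
rewrite raddfB raddfD /= Re_conj ReM_real (dot_rnorm dot_norm) /=.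
by lra.
Qed.

End Form.
End FejerForm.

(** * Discrete Fourier orthogonality at the roots of unity *)

Section RootsOfUnity.
Variable R : realType.

(* Arguments of the [N]-th roots of unity; the shift by [h] places them in
   [[-pi, pi]] when [N = 2h + 1], so that [|ei (theta s) - 1|] increases with [s]
   up to the sampling step. *)
Definition node (h N k : nat) : R := (k%:R - h%:R) * (pi *+ 2) / N%:R.

Lemma node_powN h N k : (0 < N)%N -> ei (node h N k) ^+ N = 1.
Proof.
move=> N0; rewrite ei_exp /node.
rewrite (_ : N%:R * _ = (k%:Z - h%:Z)%:~R * (pi *+ 2)) ?ei2piM//.
have : N%:R != 0 :> R by rewrite pnatr_eq0 -lt0n.
by rewrite rmorphB /= => ?; field.
Qed.

(** Up to the factor [ei (- h%:R * a)] due to the shift, this is a geometric sum of ratio [ei a], an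
    [N]-th root of unity that differs from 1 when p and r differ, as then 0 < |p - r| < N. *)
Lemma node_orthogonal h N p r : (p < N)%N -> (r < N)%N ->
  \sum_(k < N) ei (node h N k) ^+ p * Num.conj (ei (node h N k)) ^+ r =
  N%:R * (p == r)%:R.
Proof.
move=> pN rN; have N0 : N%:R != 0 :> R by rewrite pnatr_eq0 -lt0n (leq_ltn_trans _ pN).
pose a : R := (p%:R - r%:R) * (pi *+ 2) / N%:R.
have E (k : 'I_N) : ei (node h N k) ^+ p * Num.conj (ei (node h N k)) ^+ r =
    ei (- h%:R * a) * ei a ^+ k.
  rewrite conj_ei !ei_exp -!eiD; congr ei; rewrite /node /a; field.
  exact: N0.
under eq_bigr do rewrite E.
have [pr|pr] := eqVneq p r.
  rewrite /a pr subrr !mul0r mulr0 ei0.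
  under eq_bigr do rewrite expr1n mulr1.
  by rewrite sumr_const card_ord mulr1.
rewrite -mulr_sumr [RHS]mulr0.
suff -> : \sum_(k < N) ei a ^+ k = 0 by rewrite mulr0.
have a1 : ei a - 1 != 0.
  have Np : 0 < N%:R :> R by rewrite ltr0n (leq_ltn_trans _ pN).
  have p2 : 0 < pi *+ 2 :> R by rewrite mulrn_wgt0 ?pi_gt0.
  have H (q : R) : 0 < q < N%:R -> 0 < q * (pi *+ 2) / N%:R < pi *+ 2.
    move=> /andP[q0 qN]; rewrite divr_gt0 ?mulr_gt0//= ltr_pdivrMr// mulrC.
    by rewrite ltr_pM2l.
  rewrite subr_eq0; have [pr'|rp|/eqP] := ltngtP p r; last by rewrite (negbTE pr).
  - rewrite -(opprK a) -conj_ei -(rmorph1 Num.conj) (inj_eq (can_inj (@Num.Theory.conjCK _))).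
    rewrite (_ : - a = (r%:R - p%:R) * (pi *+ 2) / N%:R); last by rewrite /a; field.
    apply/ei_ne1/H; rewrite -natrB ?(ltnW pr')// ltr0n subn_gt0 pr' ltr_nat.
    by rewrite (leq_ltn_trans (leq_subr _ _)).
  - apply/ei_ne1/H; rewrite -natrB ?(ltnW rp)// ltr0n subn_gt0 rp ltr_nat.
    by rewrite (leq_ltn_trans (leq_subr _ _)).
have : (ei a - 1) * \sum_(k < N) ei a ^+ k = 0.
  rewrite -subrX1 ei_exp /a.
  rewrite (_ : N%:R * _ = (p%:Z - r%:Z)%:~R * (pi *+ 2)) ?ei2piM ?subrr//.
  by rewrite rmorphB /=; field.
by move=> /eqP; rewrite mulf_eq0 (negbTE a1) => /eqP.
Qed.

(** For an [N]-th root of unity, the power [r] is the conjugate of the power [N - r]; [0 < r] keeps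
    [N - r] below [N]. *)
Lemma node_orthogonal_conj h N p r : (p < N)%N -> (0 < r < N)%N ->
  \sum_(k < N) ei (node h N k) ^+ p * ei (node h N k) ^+ r =
  N%:R * (p == N - r)%N%:R.
Proof.
move=> pN /andP[r0 rN]; rewrite -(node_orthogonal h) ?ltn_subrL ?r0 ?(ltn_trans r0)//.
apply: eq_bigr => k _; congr (_ * _).
rewrite -[LHS]mulr1 -(expr1n _ (N - r)) -(ei_mul_conj (node h N k)) exprMn mulrA.
by rewrite -exprD subnKC ?(ltnW rN)// node_powN ?mul1r// (ltn_trans r0).
Qed.

End RootsOfUnity.

(** * Fourier inversion of the Fejer forms and their common dilation *)

Section Dilation.
Variables (R : realType) (H : completeNormedModType R[i]).
Variable dot : {dot H for Num.conj}.
Hypothesis dot_norm : forall x : H, dot x x = `|x| ^+ 2.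

(** Orthogonality of the roots of unity keeps only the term [r = p] of the first half form, with
    weight [N - p], and the term [r = N - p] of the conjugate one, with weight [p]. *)
Lemma fejer_inversion (C : H -> H) h N p x y : (p < N)%N ->
  \sum_(k < N) ei (node R h N k) ^+ p * fejer_form dot C N (ei (node R h N k)) x y =
  N%:R^-1 * ((N - p)%:R * dot (iter p C x) y +
             p%:R * Num.conj (dot (iter (N - p) C y) x)).
Proof.
move=> pN; have N0 : (0 < N)%N by exact: leq_ltn_trans pN.
have N0' : N%:R != 0 :> R[i] by rewrite pnatr_eq0 -lt0n.
pose w (k : 'I_N) : R[i] := ei (node R h N k).
have S1 : \sum_k w k ^+ p * half_form dot C N (w k) x y =
    N%:R * ((N - p)%:R * dot (iter p C x) y).
  under eq_bigr do rewrite /half_form mulr_sumr.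
  rewrite exchange_big /= (bigD1 (Ordinal pN))//= [X in _ + X]big1 ?addr0.
    have := node_orthogonal R h pN pN; rewrite eqxx mulr1 => <-.
    by rewrite mulr_suml; apply: eq_bigr => k _; rewrite /w; ring.
  move=> r rp; transitivity (((N - r)%:R * dot (iter r C x) y) *
      \sum_(k < N) w k ^+ p * Num.conj (w k) ^+ r).
    by rewrite mulr_sumr; apply: eq_bigr => k _; ring.
  rewrite node_orthogonal// (_ : (p == r :> nat) = false) ?mulr0//.
  by apply/negbTE; apply: contraNneq rp => pr; exact/eqP/val_inj.
have S2 : \sum_k w k ^+ p * Num.conj (half_form dot C N (w k) y x) =
    N%:R * (N%:R * dot x y * (p == 0)%N%:R +
            p%:R * Num.conj (dot (iter (N - p) C y) x)).
  have conjh k : Num.conj (half_form dot C N (w k) y x) =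
      \sum_(r < N) (N - r)%:R * w k ^+ r * Num.conj (dot (iter r C y) x).
    rewrite /half_form rmorph_sum /=; apply: eq_bigr => r _.
    by rewrite !rmorphM rmorphXn /= Num.Theory.conjCK rmorph_nat.
  under eq_bigr do rewrite conjh mulr_sumr.
  rewrite exchange_big /=.
  transitivity (\sum_(r < N) (N - r)%:R * Num.conj (dot (iter r C y) x) *
      \sum_(k < N) w k ^+ p * w k ^+ r).
    apply: eq_bigr => r _; rewrite mulr_sumr; apply: eq_bigr => k _; ring.
  (* The index 0 lies outside [node_orthogonal_conj]. It contributes only when [p = 0], and is then
     cancelled by the term [- N%:R * dot x y] of the form. *)
  rewrite (bigD1 (Ordinal N0))//= subn0 -dotC.
  have -> : \sum_(k < N) w k ^+ p * w k ^+ 0 = N%:R * (p == 0)%N%:R.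
    rewrite -(node_orthogonal R h pN N0); apply: eq_bigr => k _.
    by rewrite !expr0.
  have S r : (0 < r < N)%N -> \sum_(k < N) w k ^+ p * w k ^+ r = N%:R * (p == N - r)%N%:R.
    by move=> rN; rewrite -(node_orthogonal_conj R h pN rN).
  rewrite mulrDr; congr (_ + _); first by ring.
  have [p0|p0] := posnP p.
    rewrite {2}p0 mul0r mulr0 big1// => r r0; rewrite S ?ltn_ord ?andbT ?lt0n//.
    by rewrite p0 eq_sym subn_eq0 leqNgt ltn_ord !mulr0.
  have Np : (N - p < N)%N by rewrite ltn_subrL p0.
  rewrite (bigD1 (Ordinal Np))/=; last first.
    by rewrite -val_eqE /= -lt0n subn_gt0.
  rewrite S ?subn_gt0 ?pN// subKn ?(ltnW pN)// eqxx big1; first by rewrite -[true%:R]/(1 : R[i]); ring.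
  move=> r /andP[r0 rp]; rewrite S ?ltn_ord ?andbT ?lt0n//.
  rewrite (_ : (p == N - r)%N = false) ?mulr0//; apply/negbTE.
  apply: contraNneq rp => pr; apply/eqP/val_inj; rewrite /= pr subKn//.
  exact: ltnW.
transitivity (N%:R ^- 2 * (\sum_k w k ^+ p * half_form dot C N (w k) x y +
    \sum_k w k ^+ p * Num.conj (half_form dot C N (w k) y x) -
    N%:R * dot x y * \sum_k w k ^+ p)).
  rewrite mulrBr mulrDr !mulr_sumr -big_split /= -sumrB; apply: eq_bigr => k _.
  by rewrite /fejer_form /w; ring.
rewrite S1 S2.
have -> : \sum_k w k ^+ p = N%:R * (p == 0)%N%:R.
  rewrite -(node_orthogonal R h pN N0); apply: eq_bigr => k _.
  by rewrite expr0 mulr1.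
by field.
Qed.

(* The PSD forms [fejer_form w_k] sum to [dot]; factoring each of them (Naimark)
   yields an orthonormal system in which the data [l] is exactly represented.
   Every basis vector is doubled, the copies being distinguished by [bool], so
   that the two copies can be rotated at different speeds. *)
Lemma fejer_dilation (C : H -> H) (l : seq H) h N : (0 < N)%N ->
  linear C -> (forall y, rnorm (C y) <= rnorm y) -> infinite_dimensional H ->
  exists (d : nat) (g : 'I_N * 'I_d * bool -> H),
  [/\ onfam dot g,
      forall x, x \in l -> x = \sum_j dot x (g j) *: g j &
      forall x y k b, x \in l -> y \in l ->
        \sum_a dot x (g (k, a, b)) * Num.conj (dot y (g (k, a, b))) =
        2^-1 * fejer_form dot C N (ei (node R h N k)) x y].
Proof.
move=> N0 linC contrC infH; have [s os sl] := gram_schmidt dot_norm l.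
have N0' : N%:R != 0 :> R[i] by rewrite pnatr_eq0 -lt0n.
(* The factor 1/2 in [A] divides each form equally between the two copies of a basis vector. *)
pose d := size s; pose w (k : 'I_N) : R[i] := ei (node R h N k).
pose A k : 'M[R[i]]_d :=
  \matrix_(i, j) (2^-1 * fejer_form dot C N (w k) s`_i s`_j).
have conj2 : Num.conj (2^-1 : R[i]) = 2^-1 by rewrite fmorphV rmorph_nat.
have /choice[B AB] : forall k, exists B : 'M[R[i]]_d,
    forall i j, A k i j = \sum_a B i a * Num.conj (B j a).
  move=> k; have [||B AB] := @psd_factor R d (A k).
  - by move=> i j; rewrite !mxE rmorphM /= -fejer_formC conj2.
  - move=> v; pose x := \sum_i v 0 i *: s`_(i : 'I_d).
    rewrite (_ : _ 0 0 = 2^-1 * fejer_form dot C N (w k) x x).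
      rewrite mulr_ge0 ?invr_ge0 ?ler0n// fejer_form_ge0//.
      exact: rnorm_ei.
    rewrite mxE fejer_form_sumr// mulr_sumr; apply: eq_bigr => j _.
    rewrite !mxE fejer_form_suml// mulr_suml !mulr_sumr.
    by apply: eq_bigr => i _; rewrite !mxE; ring.
  - exists B => i j; rewrite AB mxE; apply: eq_bigr => a _.
    by rewrite !mxE.
pose I := ('I_N * 'I_d * bool)%type.
pose b (i : 'I_d) (j : I) := B j.1.1 i j.1.2.
have sumI (F : I -> R[i]) :
    \sum_j F j = \sum_k \sum_a \sum_c F (k, a, c).
  by rewrite pair_bigA pair_bigA; apply: eq_bigr => -[[]].
have bb i m : \sum_j b i j * Num.conj (b m j) = (i == m)%:R.
  (* The case [p = 0] of the inversion says that the Fejer forms sum to the inner product, so the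
     rows of [b] are orthonormal. *)
  rewrite sumI -val_eqE /= -os//.
  have := @fejer_inversion C h N 0 s`_i s`_m N0.
  rewrite subn0 mul0r addr0 mulrA mulVf// mul1r => <-.
  apply: eq_bigr => k _; rewrite expr0 mul1r /b /=.
  transitivity (\sum_a (B k i a * Num.conj (B k m a)) *+ 2).
    by apply: eq_bigr => a _; rewrite big_bool mulr2n.
  rewrite sumrMnl; have := AB k i m; rewrite mxE => <-.
  by rewrite /w; field.
have [g g_on sg] := onseq_realize dot_norm infH os bb.
have xE x : x \in l -> x = \sum_i dot x s`_(i : 'I_d) *: s`_i.
  by move=> /sl; rewrite proj_ord.
have sdot (i : 'I_d) j : dot s`_i (g j) = b i j.
  rewrite sg dot_suml (bigD1 j)//= dotZl g_on eqxx mulr1 big1 ?addr0// => k kj.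
  by rewrite dotZl g_on (negbTE kj) mulr0.
have xdot x j : x \in l -> dot x (g j) = \sum_i dot x s`_(i : 'I_d) * b i j.
  move=> /xE xs; rewrite {1}xs dot_suml; apply: eq_bigr => i _.
  by rewrite dotZl sdot.
exists d, g; split => // [x xl|x y k c xl yl].
  under eq_bigr do rewrite xdot// scaler_suml.
  rewrite exchange_big /= {1}(xE _ xl); apply: eq_bigr => i _.
  by rewrite {2}sg scaler_sumr; apply: eq_bigr => j _; rewrite scalerA.
rewrite {2}(xE _ xl) {2}(xE _ yl) fejer_form_suml// mulr_sumr.
under eq_bigr do rewrite !xdot// mulr_suml.
rewrite exchange_big /=; apply: eq_bigr => i _.
rewrite fejer_form_sumr// !mulr_sumr.
under eq_bigr do rewrite rmorph_sum mulr_sumr.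
rewrite exchange_big /=; apply: eq_bigr => m _.
have := AB k i m; rewrite mxE => E.
transitivity (dot x s`_i * Num.conj (dot y s`_m) *
  (\sum_a B k i a * Num.conj (B k m a))); last by rewrite -E; ring.
by rewrite mulr_sumr; apply: eq_bigr => a _; rewrite /b /= rmorphM /=; ring.
Qed.

End Dilation.

(** * Approximation by diagonal groups *)

Section RealTime.
Variables (R : realType) (H : completeNormedModType R[i]).

(* The absolute value makes [rp] total; [rp t] is [t] for [0 <= t]. *)
Definition rp (t : R) : Rplus R := `|t|%:nng.

Lemma rpK (t : Rplus R) : rp t%:num = t.
Proof. by apply: val_inj; rewrite /= ger0_norm. Qed.

Lemma rp_num (t : R) : 0 <= t -> (rp t)%:num = t.
Proof. by move=> t0; rewrite /= ger0_norm. Qed.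

Lemma continuous_rp : continuous rp.
Proof.
move=> t; apply/initial_cvgP; exact: (@norm_continuous R R^o).
Qed.

Variable T : contractive_c0_semigroup H.

Lemma sg_linear t : linear (T t).
Proof. by case: (sg_contractive T t). Qed.

Lemma sg_rnorm t x : rnorm (T t x) <= rnorm x.
Proof. by rewrite -lecR !rnormE; case: (sg_contractive T t). Qed.

Lemma sg_sub t x y : T t (x - y) = T t x - T t y.
Proof.
by rewrite addrC -scaleN1r sg_linear scaleN1r addrC.
Qed.

Lemma sg_rp0 : T (rp 0) = id.
Proof. by rewrite -(sg0 T); congr (T _); apply: val_inj; rewrite /= normr0. Qed.

Lemma sg_rpD s t x : 0 <= s -> 0 <= t -> T (rp (s + t)) x = T (rp s) (T (rp t) x).
Proof.
move=> s0 t0; rewrite -[RHS]/((T (rp s) \o T (rp t)) x) -sgD; congr (T _ x).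
by apply: val_inj; rewrite /= !ger0_norm// addr_ge0.
Qed.

Lemma sg_rpM d p x : 0 <= d -> T (rp (p%:R * d)) x = iter p (T (rp d)) x.
Proof.
move=> d0; elim: p => [|p IH] /=; first by rewrite mul0r sg_rp0.
by rewrite -natr1 mulrDl mul1r addrC sg_rpD// ?IH// mulr_ge0.
Qed.

Lemma continuous_sg_rp x : continuous (fun t => T (rp t) x).
Proof.
move=> t; apply: (@continuous_comp R (Rplus R) H rp (fun r => T r x)).
  exact: continuous_rp.
exact: sg_continuous.
Qed.

Lemma sg_near0 (l : seq H) e : 0 < e -> exists2 d, 0 < d &
  forall r x, 0 <= r <= d -> x \in l -> rnorm (T (rp r) x - x) < e.
Proof.
move=> e0; elim: l => [|x l [d d0 dl]]; first by exists 1.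
have /cvgrPdist_lt/(_ e%:C) := @continuous_sg_rp x 0.
rewrite ltcR sg_rp0 => /(_ e0)[c /= c0 hc].
exists (Num.min d (c / 2)); first by rewrite lt_min d0 divr_gt0.
move=> r y /andP[r0]; rewrite le_min => /andP[rd rc].
rewrite inE => /predU1P[->|yl]; last by apply: dl => //; rewrite r0.
rewrite rnormB -rnorm_lt; apply: hc.
by rewrite /= sub0r normrN ger0_norm//; lra.
Qed.

End RealTime.

Section Approximation.
Variables (R : realType) (H : completeNormedModType R[i]).
Variable dot : {dot H for Num.conj}.
Hypothesis dot_norm : forall x : H, dot x x = `|x| ^+ 2.

Lemma onfam_rnorm (I : finType) (g : I -> H) (c : I -> R[i]) : onfam dot g ->
  rnorm (\sum_j c j *: g j) ^+ 2 = \sum_j rnorm (c j) ^+ 2.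
Proof.
move=> g_on; apply: complexI; rewrite -(dot_rnorm dot_norm) dot_suml rmorph_sum.
apply: eq_bigr => j _ /=; rewrite -mul_conj dotZl dot_sumr (bigD1 j)//= dotZr.
rewrite g_on eqxx mulr1 big1 ?addr0// => k kj.
by rewrite dotZr g_on eq_sym (negbTE kj) mulr0.
Qed.

(** Compare coordinate by coordinate: while the phases stay in [[-pi, pi]], each |e^(i theta t) - 1|
    grows with |t|. *)
Lemma diag_sub_le (I : finType) (g : I -> H) (theta : I -> R) s t x :
  onfam dot g ->
  (forall j, `|theta j * s| <= `|theta j * t| /\ `|theta j * t| <= pi) ->
  rnorm (diag_fun dot g theta s x - x) <= rnorm (diag_fun dot g theta t x - x).
Proof.
move=> g_on st.
have : rnorm (diag_fun dot g theta s x - x) ^+ 2 <=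
       rnorm (diag_fun dot g theta t x - x) ^+ 2.
  rewrite /diag_fun ![x + _]addrC !addrK !onfam_rnorm//; apply: ler_sum => j _.
  rewrite !rnormM !exprMn ler_wpM2r ?exprn_ge0 ?rnorm_ge0//.
  by rewrite ler_sqr ?nnegrE ?rnorm_ge0//; apply: rnorm_ei_sub1_le; case: (st j).
by rewrite ler_sqr ?nnegrE ?rnorm_ge0.
Qed.

(** For an isometry, weak closeness to the identity at [x] already gives norm closeness. *)
Lemma diag_sub_sqr (I : finType) (g : I -> H) (theta : I -> R) t x :
  onfam dot g -> rnorm (diag_fun dot g theta t x - x) ^+ 2 =
    2 * complex.Re (dot x x - dot (diag_fun dot g theta t x) x).
Proof.
move=> g_on; rewrite (rnorm_sqrB dot_norm) (diag_isometry dot_norm)//.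
by rewrite raddfB /= -(rnorm_sqr dot_norm); ring.
Qed.

Lemma node_le_pi h k : (k < h.*2.+1)%N -> `|node R h h.*2.+1 k| <= pi.
Proof.
move=> kh; rewrite /node.
have kh' : k%:R <= h%:R * 2 :> R.
  by rewrite -natrM ler_nat muln2 -ltnS.
have p0 := pi_gt0 R; have h0 : 0 <= h%:R :> R by [].
have k0 : 0 <= k%:R :> R by [].
have N0 : 0 < h.*2.+1%:R :> R by [].
have -> : h.*2.+1%:R = h%:R * 2 + 1 :> R by rewrite -natr1 -muln2 natrM.
have N1 : 0 < h%:R * 2 + 1 :> R by lra.
rewrite ler_norml mulr2n ler_pdivrMr// ler_pdivlMr//; apply/andP; split; nra.
Qed.

(** Round [theta * tau] down to a multiple of 2 pi, add [a] and divide by [tau]: any phase can be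
    prescribed at time [tau] at a cost of order [1 / tau]. *)
Lemma close_frequency (theta tau a : R) : 0 < tau -> exists theta',
  ei (theta' * tau) = ei a /\ `|theta' - theta| <= (pi *+ 2 + `|a|) / tau.
Proof.
move=> tau0; have p2 : 0 < pi *+ 2 :> R by rewrite mulrn_wgt0 ?pi_gt0.
pose m := Num.floor (theta * tau / (pi *+ 2)).
exists ((m%:~R * (pi *+ 2) + a) / tau); split.
  by rewrite divfK ?gt_eqF// eiD ei2piM mul1r.
have -> : (m%:~R * (pi *+ 2) + a) / tau - theta =
    (m%:~R * (pi *+ 2) + a - theta * tau) / tau.
  by field; rewrite gt_eqF.
rewrite normrM normfV (gtr0_norm tau0) ler_pM2r ?invr_gt0//.
rewrite addrAC; apply: le_trans (ler_normD _ _) _; rewrite lerD2r.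
have := real_floor_le (num_real (theta * tau / (pi *+ 2))).
have := real_floorD1_gt (num_real (theta * tau / (pi *+ 2))).
rewrite -/m ler_pdivlMr// ltr_pdivrMr// rmorphD /= mulrDl mul1r => m1 m2.
by rewrite ler_norml; apply/andP; split; lra.
Qed.

(** * Weak comparison of a semigroup with its diagonal model on a bounded time interval *)

Section Close.
Variables (T : contractive_c0_semigroup H) (l : seq H) (B delta eps1 rho : R).
Variables (h d : nat).
Let N := h.*2.+1.
Variable g : 'I_N * 'I_d * bool -> H.
Hypotheses (B0 : 0 <= B) (lB : forall x, x \in l -> rnorm x <= B).
Hypotheses (delta0 : 0 < delta) (eps1_ge0 : 0 <= eps1) (rho0 : 0 <= rho).
Hypothesis Tdelta : forall r x, 0 <= r <= delta -> x \in l ->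
  rnorm (T (rp r) x - x) <= eps1.
Hypothesis rhoB : 2 * (eps1 * B + 2 * B ^+ 2 / N%:R) <= rho ^+ 2.
Hypothesis g_on : onfam dot g.
Hypothesis lg : forall x, x \in l -> x = \sum_j dot x (g j) *: g j.
Hypothesis gform : forall x y k b, x \in l -> y \in l ->
  \sum_a dot x (g (k, a, b)) * Num.conj (dot y (g (k, a, b))) =
  2^-1 * fejer_form dot (T (rp delta)) N (ei (node R h N k)) x y.

(** At time [delta] the vector [g (k, a, b)] is multiplied by the [k]-th root of unity, so sampling
    at multiples of [delta] produces the sums of [fejer_inversion]. *)
Definition freq (j : 'I_N * 'I_d * bool) : R := node R h N j.1.1 / delta.

Let S0 := diag_fun dot g freq.

Lemma sum_pairs (F : 'I_N * 'I_d * bool -> R[i]) :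
  \sum_j F j = \sum_k \sum_b \sum_a F (k, a, b).
Proof.
under [RHS]eq_bigr do rewrite exchange_big.
by rewrite pair_bigA pair_bigA; apply: eq_bigr => -[[]].
Qed.

Lemma diag_node p x y : (p < N)%N -> x \in l -> y \in l ->
  dot (S0 (p%:R * delta) x) y =
  N%:R^-1 * ((N - p)%:R * dot (T (rp (p%:R * delta)) x) y +
             p%:R * Num.conj (dot (T (rp ((N - p)%:R * delta)) y) x)).
Proof.
move=> pN xl yl; rewrite (diag_coef _ _ _ (lg xl)) sum_pairs.
rewrite !sg_rpM ?(ltW delta0)// -(@fejer_inversion R H dot _ h N)//.
apply: eq_bigr => k _; rewrite big_bool /=.
have E b : \sum_a ei (freq (k, a, b) * (p%:R * delta)) *
    (dot x (g (k, a, b)) * Num.conj (dot y (g (k, a, b)))) =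
    ei (node R h N k) ^+ p *
    (2^-1 * fejer_form dot (T (rp delta)) N (ei (node R h N k)) x y).
  rewrite -(gform _ b)// mulr_sumr; apply: eq_bigr => a _; congr (_ * _).
  rewrite ei_exp /freq /=; congr ei; field; exact: lt0r_neq0.
by rewrite !E; field.
Qed.

Lemma rnorm_dot_le x y : x \in l -> y \in l -> forall t, rnorm (dot (T t x) y) <= B ^+ 2.
Proof.
move=> xl yl t; apply: le_trans (cauchy_schwarz dot_norm _ _) _.
rewrite expr2 ler_pM ?rnorm_ge0//; last exact: lB.
exact: le_trans (sg_rnorm _ _ _) (lB xl).
Qed.

(** By [diag_node] the difference is [p / N] times a difference of two coefficients, each of modulus
    at most [B ^+ 2]. *)
Lemma diag_node_close p x y : (p < N)%N -> x \in l -> y \in l ->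
  rnorm (dot (S0 (p%:R * delta) x) y - dot (T (rp (p%:R * delta)) x) y) <=
  2 * p%:R * B ^+ 2 / N%:R.
Proof.
move=> pN xl yl; rewrite diag_node//.
have N0 : N%:R != 0 :> R[i] by rewrite pnatr_eq0.
set u := dot (T _ x) y; set v := dot (T _ y) x.
have -> : N%:R^-1 * ((N - p)%:R * u + p%:R * Num.conj v) - u =
    (p%:R / N%:R)%:C * (Num.conj v - u).
  rewrite rmorphM fmorphV /= !rmorph_nat natrB ?(ltnW pN)//.
  by field.
rewrite rnormM rnorm_real ger0_norm ?divr_ge0//.
have -> : 2 * p%:R * B ^+ 2 / N%:R = p%:R / N%:R * (B ^+ 2 + B ^+ 2) by ring.
rewrite ler_wpM2l ?divr_ge0//.
apply: le_trans (ler_rnormB _ _) _; rewrite rnorm_conj.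
by rewrite lerD// rnorm_dot_le.
Qed.

(** By monotonicity it suffices to treat [r = delta]. There the sample [p = 1] is weakly close to
    [T (rp delta)], itself close to the identity on [l], and [diag_sub_sqr] turns this into a norm
    bound. *)
Lemma diag_small r x : 0 <= r <= delta -> (0 < h)%N -> x \in l ->
  rnorm (S0 r x - x) <= rho.
Proof.
move=> /andP[r0 rd] h0 xl; apply: (@le_trans _ _ (rnorm (S0 delta x - x))).
  apply: diag_sub_le => // j; rewrite /freq; split.
    rewrite !normrM ler_wpM2l ?mulr_ge0// (ger0_norm r0) ger0_norm//.
    exact: ltW.
  by rewrite divfK ?gt_eqF// node_le_pi.
have : rnorm (S0 delta x - x) ^+ 2 <= rho ^+ 2.
  apply: le_trans rhoB; rewrite diag_sub_sqr// ler_pM2l//.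
  have N1 : (1 < N)%N by rewrite ltnS double_gt0.
  have := diag_node_close N1 xl xl; rewrite mul1r mulr1 => c1.
  have -> : dot x x - dot (S0 delta x) x =
    - (dot (S0 delta x) x - dot (T (rp delta) x) x) - dot (T (rp delta) x - x) x.
    by rewrite dotBl; ring.
  rewrite raddfB raddfN /=.
  have := Re_le_rnorm (dot (S0 delta x) x - dot (T (rp delta) x) x).
  have := Re_le_rnorm (dot (T (rp delta) x - x) x).
  have : rnorm (dot (T (rp delta) x - x) x) <= eps1 * B.
    apply: le_trans (cauchy_schwarz dot_norm _ _) _; rewrite ler_pM ?rnorm_ge0 ?lB//.
    by apply: Tdelta => //; rewrite lexx ltW.
  rewrite !ler_norml => + /andP[+ _] /andP[+ _].
  by move: c1; set z := 2 * _ / _ => *; lra.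
by rewrite ler_sqr ?nnegrE ?rnorm_ge0.
Qed.

(** Round [t] down to a multiple of [delta]. The three errors come from moving the diagonal group to
    that sample, comparing there, and moving back along [T]. *)
Lemma diag_close t m x y : (0 < h)%N -> 0 <= t -> t <= m%:R * delta -> (m < N)%N ->
  x \in l -> y \in l ->
  rnorm (dot (S0 t x) y - dot (T (rp t) x) y) <=
  rho * B + 2 * m%:R * B ^+ 2 / N%:R + eps1 * B.
Proof.
move=> h0 t0 tm mN xl yl; pose p := Num.truncn (t / delta).
have td0 : 0 <= t / delta by rewrite divr_ge0// ltW.
have /andP[p1 p2] := truncn_itv td0.
rewrite -/p in p1 p2; rewrite ler_pdivlMr// in p1; rewrite ltr_pdivrMr// in p2.
have pm : (p <= m)%N.
  rewrite -(ler_nat R) -(ler_pM2r delta0); exact: le_trans tm.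
have pN : (p < N)%N by exact: leq_ltn_trans mN.
pose r := t - p%:R * delta.
have r0 : 0 <= r <= delta.
  by rewrite /r subr_ge0 p1/=; move: p2; rewrite -natr1 mulrDl; lra.
have tE : t = p%:R * delta + r by rewrite /r addrC subrK.
have pd0 : 0 <= p%:R * delta by rewrite mulr_ge0// ltW.
have rr : 0 <= r by case/andP: r0.
apply: le_trans (ler_rnorm_trans _ (dot (S0 (p%:R * delta) x) y) _) _.
rewrite -addrA lerD//.
  rewrite tE -dotBl /S0 diagD//=.
  have -> u v : diag_fun dot g freq (p%:R * delta) u - diag_fun dot g freq (p%:R * delta) v
     = diag_fun dot g freq (p%:R * delta) (u - v).
    by rewrite addrC -scaleN1r -(diag_linear dot g freq _ (-1) v u) scaleN1r addrC.
  apply: le_trans (cauchy_schwarz dot_norm _ _) _; rewrite (diag_isometry dot_norm)//.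
  by rewrite ler_pM ?rnorm_ge0 ?lB//; exact: diag_small.
apply: le_trans (ler_rnorm_trans _ (dot (T (rp (p%:R * delta)) x) y) _) _.
rewrite lerD//.
  apply: le_trans (diag_node_close pN xl yl) _.
  rewrite ler_pM2r ?invr_gt0 ?ltr0n// ler_wpM2r ?sqr_ge0// ler_pM2l//.
  by rewrite ler_nat.
rewrite tE sg_rpD// -dotBl -sg_sub.
apply: le_trans (cauchy_schwarz dot_norm _ _) _.
rewrite ler_pM ?rnorm_ge0 ?lB//; apply: le_trans (sg_rnorm _ _ _) _.
by rewrite rnormB; exact: Tdelta.
Qed.

End Close.

(** The parameters are fixed in this order: the step [delta] by strong continuity, [m] to cover the
    time interval, [N] to make the samples accurate, and last the time [tau], so late that the
    frequencies barely move. The copies indexed by [b] receive the phase [a b] at [tau], whence the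
    half sum. *)
Lemma semigroup_approx (T : contractive_c0_semigroup H) (l : seq H)
    (L e t0 : R) (a : bool -> R) : infinite_dimensional H -> 0 < e ->
  exists S : contractive_c0_semigroup H,
    (forall t x y, t%:num <= L -> x \in l -> y \in l ->
       rnorm (dot (S t x - T t x) y) < e) /\
    exists2 tau : Rplus R, t0 <= tau%:num & forall x y, x \in l -> y \in l ->
      dot (S tau x) y = 2^-1 * (ei (a true) + ei (a false)) * dot x y.
Proof.
move=> infH e0; pose B : R := 1 + \sum_(x <- l) rnorm x.
have sum0 (s : seq H) : 0 <= \sum_(x <- s) rnorm x.
  by apply: sumr_ge0 => x _; exact: rnorm_ge0.
have B1 : 1 <= B by rewrite lerDl.
have B0 : 0 < B by exact: lt_le_trans B1.
have lB x : x \in l -> rnorm x <= B.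
  move=> xl; rewrite /B (big_rem x)//= addrCA lerDl.
  by rewrite addr_ge0// sum0.
(* Error budget: e/4 from [rho * B], e/8 from the samples, e/8 from [eps1 * B] and e/4 from changing
   the frequencies, in all 3e/4. *)
clearbody B; pose rho := e / (4 * B).
have rho0 : 0 < rho by rewrite divr_gt0// mulr_gt0.
pose eps1 := Num.min (e / (8 * B)) (rho ^+ 2 / (4 * B)).
have eps10 : 0 < eps1.
  rewrite lt_min; apply/andP; split; apply: divr_gt0; rewrite ?(mulr_gt0 _ B0)//.
  exact: exprn_gt0.
have e1B : eps1 * B <= e / 8.
  have : eps1 <= e / (8 * B) by rewrite ge_min lexx.
  by rewrite ler_pdivlMr ?(mulr_gt0 _ B0)//; lra.
have e2B : eps1 * B <= rho ^+ 2 / 4.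
  have : eps1 <= rho ^+ 2 / (4 * B) by rewrite ge_min lexx orbT.
  by rewrite ler_pdivlMr ?(mulr_gt0 _ B0)//; lra.
have [delta delta0 Tdelta] := sg_near0 T l eps10.
pose L' := Num.max L 0.
pose m := (Num.truncn (L' / delta)).+1.
have Lm : L' <= m%:R * delta.
  by rewrite -ler_pdivrMr//; apply/ltW/truncnS_gt.
clearbody m.
(* Once [N] exceeds [K], the first summand gives [b1] and the second gives [b2]. *)
pose K := 16 * m%:R * B ^+ 2 / e + 8 * B ^+ 2 / rho ^+ 2.
have m0 : 0 <= m%:R :> R by [].
have K1 : 0 <= 16 * m%:R * B ^+ 2 / e.
  by rewrite divr_ge0 ?(ltW e0)// mulr_ge0 ?sqr_ge0// mulr_ge0.
have K2 : 0 <= 8 * B ^+ 2 / rho ^+ 2.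
  by rewrite divr_ge0 ?sqr_ge0// mulr_ge0 ?sqr_ge0.
pose h := (Num.truncn K + m).+1; pose N := h.*2.+1.
have hN : (h <= N)%N by rewrite /N -addnn -addnS leq_addr.
have NK : K <= N%:R.
  apply: le_trans (ltW (truncnS_gt K)) _; rewrite ler_nat.
  by apply: leq_trans hN; rewrite ltnS leq_addr.
have N0 : 0 < N%:R :> R by rewrite ltr0n.
have mN : (m < N)%N by apply: leq_trans hN; rewrite ltnS leq_addl.
have h0 : (0 < h)%N by [].
clearbody h.
have b1 : 2 * m%:R * B ^+ 2 / N%:R <= e / 8.
  rewrite ler_pdivrMr//; move: NK; rewrite /K => NK.
  have : 16 * m%:R * B ^+ 2 / e <= N%:R by lra.
  by rewrite ler_pdivrMr//; lra.
have b2 : 2 * (eps1 * B + 2 * B ^+ 2 / N%:R) <= rho ^+ 2.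
  have : 2 * B ^+ 2 / N%:R <= rho ^+ 2 / 4.
    rewrite ler_pdivrMr//; move: NK; rewrite /K => NK.
    have : 8 * B ^+ 2 / rho ^+ 2 <= N%:R by lra.
    by rewrite ler_pdivrMr ?exprn_gt0//; lra.
  by lra.
have Tlin : linear (T (rp delta)) by exact: sg_linear.
have [d [g [g_on lg gform]]] := fejer_dilation dot_norm l h (isT : (0 < N)%N)
  Tlin (sg_rnorm T _) infH.
pose th0 := @freq delta h d.
pose cJ : R := #|{: 'I_N * 'I_d * bool}|%:R.
have cJ0 : 0 <= cJ by [].
(* Each of the [cJ] terms of an exponential sum has weight at most [B ^+ 2]; the [+ 1] covers an
   empty index set. *)
pose eta := e / (4 * (cJ + 1) * B ^+ 2).
have eta0 : 0 < eta by rewrite divr_gt0// !mulr_gt0 ?exprn_gt0// ltr_wpDl.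
have [w w0 hw] := ei_near0 eta0.
pose U := pi *+ 2 + (`|a true| + `|a false|).
have U0 : 0 < U by rewrite ltr_wpDr ?addr_ge0// mulrn_wgt0// pi_gt0.
have L'0 : 0 <= L' by rewrite le_max lexx orbT.
(* Frequencies move by at most [U / tau], hence phases by less than [w] up to time [L']; the entry 1
   makes [tau] positive. *)
pose tau := Num.max (Num.max t0 1) (U * (L' + 1) / w).
have tau0 : 0 < tau by rewrite !lt_max ltr01 orbT.
have tauw : U * (L' + 1) / w <= tau by rewrite le_max lexx orbT.
have /choice[th th_tau] : forall j : 'I_N * 'I_d * bool, exists th,
    ei (th * tau) = ei (a j.2) /\ `|th - th0 j| <= (pi *+ 2 + `|a j.2|) / tau.
  by move=> j; exact: close_frequency.
exists (diag_sg dot_norm th g_on); split; last first.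
  exists (rp tau); first by rewrite rp_num ?(ltW tau0)// !le_max lexx.
  move=> x y xl yl; rewrite /= /diag_sg_fun rp_num ?(ltW tau0)//.
  rewrite (diag_coef _ _ _ (lg _ xl)) sum_pairs.
  have := @fejer_inversion R H dot (T (rp delta)) h N 0 x y isT.
  rewrite subn0 mul0r addr0 mulrA mulVf ?pnatr_eq0// mul1r /= => <-.
  rewrite mulr_sumr; apply: eq_bigr => k _; rewrite big_bool /= expr0 mul1r.
  have E b : \sum_a0 ei (th (k, a0, b) * tau) * (dot x (g (k, a0, b)) *
      Num.conj (dot y (g (k, a0, b)))) =
      ei (a b) * (2^-1 * fejer_form dot (T (rp delta)) N (ei (node R h N k)) x y).
    rewrite -(gform _ _ _ b)// mulr_sumr; apply: eq_bigr => c _.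
    by have [-> _] := th_tau (k, c, b).
  by rewrite !E; ring.
move=> t x y tL xl yl; rewrite /= /diag_sg_fun dotBl.
have t_ge0 : 0 <= t%:num by [].
have tL' : t%:num <= L' by rewrite le_max tL.
apply: le_lt_trans (ler_rnorm_trans _ (dot (diag_fun dot g th0 t%:num x) y) _) _.
have D1 : rnorm (dot (diag_fun dot g th0 t%:num x) y - dot (T t x) y) <=
    rho * B + 2 * m%:R * B ^+ 2 / N%:R + eps1 * B.
  rewrite -[t in T t]rpK; apply: (diag_close (l := l) (eps1 := eps1)) => //; try exact: ltW.
  - by move=> r z rd zl; apply/ltW/Tdelta.
  - exact: le_trans Lm.
have D2 : rnorm (dot (diag_fun dot g th t%:num x) y -
                 dot (diag_fun dot g th0 t%:num x) y) <= e / 4.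
  rewrite !(diag_coef _ _ _ (lg _ xl)) -sumrB.
  apply: le_trans (ler_rnorm_sum _ _ _) _.
  apply: (@le_trans _ _ (\sum_(j : 'I_N * 'I_d * bool) eta * B ^+ 2)); last first.
    have -> : \sum_(j : 'I_N * 'I_d * bool) eta * B ^+ 2 = e / 4 * (cJ / (cJ + 1)).
      rewrite sumr_const -mulr_natl -/cJ /eta; field.
      by rewrite !gt_eqF// ltr_wpDl.
    rewrite ler_piMr ?divr_ge0 ?(ltW e0)// ler_pdivrMr ?mul1r ?lerDl//.
    by rewrite ltr_wpDl.
  apply: ler_sum => j _; rewrite -mulrBl rnormM ler_pM ?rnorm_ge0//.
    rewrite rnorm_ei_sub; apply/ltW/hw; rewrite -mulrBl normrM (ger0_norm t_ge0).
    have [_ thj] := th_tau j.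
    have ajU : pi *+ 2 + `|a j.2| <= U.
      rewrite lerD2l; case: (j.2); rewrite ?lerDl ?lerDr//.
    apply: (@le_lt_trans _ _ (U / tau * L')).
      rewrite ler_pM//; apply: le_trans thj _.
      by rewrite ler_pM2r ?invr_gt0.
    apply: (@lt_le_trans _ _ (U / tau * (L' + 1))).
      by rewrite ltr_pM2l ?divr_gt0// ltrDl.
    by rewrite mulrAC ler_pdivrMr// [w * _]mulrC -ler_pdivrMr.
  rewrite rnormM rnorm_conj expr2.
  have gj : rnorm (g j) = 1.
    apply/eqP; rewrite -(@eqrXn2 _ 2) ?rnorm_ge0// (rnorm_sqr dot_norm) g_on eqxx.
    by rewrite expr1n.
  by rewrite ler_pM ?rnorm_ge0//; apply: le_trans (cauchy_schwarz dot_norm _ _) _;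
    rewrite gj mulr1 lB.
have rB : rho * B = e / 4 by rewrite /rho; field; rewrite gt_eqF.
by apply: le_lt_trans (lerD D2 D1) _; rewrite rB; lra.
Qed.

End Approximation.

(** * Generic recurrence *)

Section Genericity.
Variables (R : realType) (H : completeNormedModType R[i]).
Variable dot : {dot H for Num.conj}.
Hypothesis dot_norm : forall x : H, dot x x = `|x| ^+ 2.

Lemma separable_seq : separable H ->
  exists xs : nat -> H, forall x e, 0 < e -> exists n, rnorm (x - xs n) < e.
Proof.
move=> [D /countable_injP[f finj] dD].
(* This inverts the injection [f] of [D] into [nat]; indices outside its image get the harmless
   value 0. *)
pose xs n := xget 0 [set x | D x /\ f x = n].
exists xs => x e e0; have [|y [xy Dy]] := dD (ball x e%:C) _ (ball_open x e%:C).
- by exists x; apply: ballxx; rewrite ltcR.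
- exists (f y); rewrite -rnorm_lt; suff -> : xs (f y) = y by move: xy; rewrite -ball_normE.
  have [Dx fx] : D (xs (f y)) /\ f (xs (f y)) = f y.
    by apply: (@xgetPex _ 0 [set x | D x /\ f x = f y]); exists y.
  by apply: finj; rewrite ?inE.
Qed.

Definition weak_nbd (T : Cs dot) (l : seq H) (L e : R) : set (Cs dot) :=
  [set S : Cs dot | forall (t : Rplus R) x y, t%:num <= L -> x \in l -> y \in l ->
     rnorm (dot (S t x - T t x) y) < e].

(** The sets [weak_nbd T l L e] generate a filter, which converges to [T] by [cvg_CsP] because a
    compact set of times is bounded; so it contains every neighbourhood of [T]. *)
Lemma weak_nbd_base (T : Cs dot) (O : set (Cs dot)) : nbhs T O ->
  exists l L e, 0 < e /\ weak_nbd T l L e `<=` O.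
Proof.
pose F := filter_from [set p : seq H * R * R | 0 < p.2]
  (fun p => weak_nbd T p.1.1 p.1.2 p.2).
have FF : Filter F.
  apply: filter_from_filter; first by exists ([::], 0, 1) => /=.
  move=> [[l1 L1] e1] [[l2 L2] e2] /= e10 e20.
  exists (l1 ++ l2, Num.max L1 L2, Num.min e1 e2) => /=; first by rewrite lt_min e10.
  move=> S hS; split => t x y tL xl yl.
    have := hS t x y; rewrite le_max tL !mem_cat xl yl => /(_ isT isT isT).
    by rewrite lt_min => /andP[].
  have := hS t x y; rewrite le_max tL !mem_cat xl yl !orbT => /(_ isT isT isT).
  by rewrite lt_min => /andP[].
have FT : F --> T.
  apply/cvg_CsP => x y K cK _ /gt0_complexE[e e0 ->].
  have : compact ((fun t : Rplus R => t%:num : R^o) @` K).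
    apply: continuous_compact => //; apply: continuous_subspaceT => t.
    exact: initial_continuous.
  move=> /compact_bounded[M [_ /(_ (M + 1))]]; rewrite ltrDl ltr01 => /(_ isT) KM.
  exists ([:: x; y], M + 1, e) => //= S hS t Kt; rewrite rnorm_lt.
  apply: hS; rewrite ?inE ?eqxx ?orbT//.
  by apply: le_trans (KM t%:num _); [exact: ler_norm | exists t].
by move=> /FT[[[l L] e] /= e0 lO]; exists l, L, e.
Qed.

Variable xs : nat -> H.

(** One index governs the lateness of the time, the number of test vectors and the precision, so
    that countably many conditions suffice. *)
Definition recurrent (n : nat) (z : R[i]) : set (Cs dot) :=
  [set T : Cs dot | exists2 t : Rplus R, n%:R <= t%:num & forall k m : 'I_n,
     rnorm (dot (T t (xs k)) (xs m) - z * dot (xs k) (xs m)) < n.+1%:R^-1].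

(** The witness [t] of [T] also works nearby: only finitely many strict inequalities at the compact
    set [[set t]] must be preserved. *)
Lemma recurrent_open n z : open (recurrent n z).
Proof.
rewrite openE => T [t nt ht]; rewrite /interior.
have /cvg_CsP near_T : nbhs T --> T by [].
pose P (km : 'I_n * 'I_n) : set (Cs dot) := [set S : Cs dot |
    rnorm (dot (S t (xs km.1) - T t (xs km.1)) (xs km.2)) <
    n.+1%:R^-1 - rnorm (dot (T t (xs km.1)) (xs km.2) - z * dot (xs km.1) (xs km.2))].
have : nbhs T [set S | forall km, P km S].
  apply: (@filter_forall (Cs dot) _ P (nbhs T)) => -[k m]; rewrite /P /=.
  set e := _ - _; have e0 : 0 < e by rewrite subr_gt0.
  have := near_T (xs k) (xs m) [set t] (@compact_set1 _ t) e%:C.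
  rewrite ltcR => /(_ e0); apply: filterS => S /(_ t erefl).
  by rewrite rnorm_lt.
apply: filterS => S hS; exists t => // k m; have := hS (k, m); rewrite /P /= dotBl => h.
apply: le_lt_trans (ler_rnorm_trans _ (dot (T t (xs k)) (xs m)) _) _.
by rewrite -ltrBrDr.
Qed.

(** Adjoin the first [n] vectors [xs k] to those defining the neighbourhood; [semigroup_approx] then
    reaches the scalar exactly on them. *)
Lemma recurrent_dense n (a : bool -> R) : infinite_dimensional H ->
  dense (recurrent n (2^-1 * (ei (a true) + ei (a false)))).
Proof.
move=> infH O [T OT] oO.
have [l [L [e [e0 lO]]]] := weak_nbd_base (open_nbhs_nbhs (conj oO OT)).
have [S [near_S [t nt St]]] := semigroup_approx dot_norm T
  (l ++ [seq xs k | k <- iota 0 n]) L n%:R a infH e0.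
exists S; split.
  by apply: lO => t' x y tL xl yl; apply: near_S; rewrite ?mem_cat ?xl ?yl.
exists t => // k m; rewrite St ?subrr ?rnorm0 ?invr_gt0//.
  by rewrite mem_cat map_f ?orbT// mem_iota /=.
by rewrite mem_cat map_f ?orbT// mem_iota /=.
Qed.

End Genericity.

(** * From recurrence on a dense sequence to all vectors *)

Section Recurrence.
Variables (R : realType) (H : completeNormedModType R[i]).
Variable dot : {dot H for Num.conj}.
Hypothesis dot_norm : forall x : H, dot x x = `|x| ^+ 2.
Variable xs : nat -> H.
Hypothesis xs_dense : forall x e, 0 < e -> exists n, rnorm (x - xs n) < e.
Variable T : Cs dot.

Lemma invS_lt (e : R) : 0 < e -> exists n, forall m, (n <= m)%N -> m.+1%:R^-1 < e.
Proof.
move=> e0; exists (Num.truncn e^-1) => m nm.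
rewrite -[e]invrK ltf_pV2 ?posrE ?invr_gt0//.
by apply: lt_le_trans (truncnS_gt _) _; rewrite ler_nat ltnS.
Qed.

(** A rational angle close to [a] costs e/2 on the first [n] vectors, and recurrence at a large
    index costs the other half. *)
Lemma recurrent_ei : (forall n (q : rat), recurrent xs n (ei (ratr q)) T) ->
  forall (a : R) n e, 0 < e -> exists2 t : Rplus R, n%:R <= t%:num &
    forall k : nat, (k < n)%N ->
      rnorm (dot (T t (xs k)) (xs k) - ei a * dot (xs k) (xs k)) < e.
Proof.
move=> recT a n e e0.
pose B : R := 1 + \sum_(k < n) rnorm (dot (xs k) (xs k)).
have B0 : 0 < B by rewrite ltr_wpDr// sumr_ge0// => k _; exact: rnorm_ge0.
have eB0 : 0 < e / 2 / B by rewrite !divr_gt0.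
have [d d0 hd] := ei_near0 eB0.
have [q] : exists q : rat, ratr q \in `]a, (a + d)[.
  by apply: rat_in_itvoo; rewrite ltrDl.
rewrite in_itv /= => /andP[aq qd].
have [n1 hn1] := invS_lt (divr_gt0 e0 (ltr0Sn R 1)).
have [t nt ht] := recT (maxn n n1) q.
exists t => [|k kn]; first by apply: le_trans nt; rewrite ler_nat leq_maxl.
have kn' : (k < maxn n n1)%N by rewrite leq_max kn.
have := lt_trans (ht (Ordinal kn') (Ordinal kn')) (hn1 _ (leq_maxr _ _)).
rewrite /= => h1.
apply: le_lt_trans (ler_rnorm_trans _ (ei (ratr q) * dot (xs k) (xs k)) _) _.
suff : rnorm (ei (ratr q) * dot (xs k) (xs k) - ei a * dot (xs k) (xs k)) < e / 2.
  by move=> ?; lra.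
rewrite -mulrBl rnormM; apply: (@le_lt_trans _ _ (rnorm (ei (ratr q) - ei a) * B)).
  rewrite ler_wpM2l ?rnorm_ge0// /B (bigD1 (Ordinal kn))//= addrCA lerDl.
  by rewrite addr_ge0// sumr_ge0// => i _; exact: rnorm_ge0.
rewrite -ltr_pdivlMr// rnorm_ei_sub; apply: hd.
by rewrite ger0_norm; lra.
Qed.

Lemma dist_scalar_sqr t (z : R[i]) x : rnorm z = 1 ->
  rnorm (T t x - z *: x) ^+ 2 <= 2 * rnorm (dot (T t x) x - z * dot x x).
Proof.
move=> z1; rewrite (rnorm_sqrB dot_norm) rnormZ z1 mul1r dotZr.
set D := dot (T t x) x - z * dot x x.
have -> : Num.conj z * dot (T t x) x = Num.conj z * D + dot x x.
  rewrite /D mulrBr mulrA [Num.conj z * z]mulrC mul_conj z1 expr1n mul1r.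
  by rewrite subrK.
rewrite raddfD /= -(rnorm_sqr dot_norm).
have : - rnorm D <= complex.Re (Num.conj z * D).
  rewrite lerNl; apply: le_trans (ler_norm _) _; rewrite normrN.
  by apply: le_trans (Re_le_rnorm _) _; rewrite rnormM rnorm_conj z1 mul1r.
have : rnorm (T t x) ^+ 2 <= rnorm x ^+ 2.
  by rewrite ler_sqr ?nnegrE ?rnorm_ge0// sg_rnorm.
by move=> h1 h2; lra.
Qed.

(** Replacing [x] by [y] costs e/4 twice, and [dist_scalar_sqr] turns the bound [e ^+ 2 / 8] into
    e/2 at [y]. *)
Lemma dist_scalar_lt t (z : R[i]) x y e : rnorm z = 1 -> 0 < e ->
  rnorm (x - y) < e / 4 ->
  rnorm (dot (T t y) y - z * dot y y) < e ^+ 2 / 8 ->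
  rnorm (T t x - z *: x) < e.
Proof.
move=> z1 e0 xy hy.
have h1 : rnorm (T t y - z *: y) < e / 2.
  have := dist_scalar_sqr t y z1; have := rnorm_ge0 (T t y - z *: y).
  by move=> ? ?; nra.
have -> : T t x - z *: x = T t (x - y) + (T t y - z *: y) - z *: (x - y).
  by rewrite sg_sub scalerBr opprB (addrA (T t x - _)) subrK addrA subrK.
apply: le_lt_trans (ler_rnormB _ _) _; rewrite rnormZ z1 mul1r.
have := ler_rnormD (T t (x - y)) (T t y - z *: y); have := sg_rnorm T t (x - y).
by move=> ? ?; lra.
Qed.

Lemma scalar_limits : (forall n (q : rat), recurrent xs n (ei (ratr q)) T) ->
  unimodular_scalar_limits T.
Proof.
move=> recT alpha alpha1.
have {}alpha1 : rnorm alpha = 1 by rewrite /rnorm alpha1.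
have [a aE] := unit_circleP alpha1; have rec_a := recurrent_ei recT a.
(* The subnet is indexed by times paired with a quality of approximation, ordered in both
   coordinates: the time makes the index map monotone and the quality improves along tails.
   Directedness holds as [cofinal] makes both coordinates large at once. *)
pose P (p : Rplus R * nat) := forall k : nat, (k < p.2)%N ->
  rnorm (dot (T p.1 (xs k)) (xs k) - alpha * dot (xs k) (xs k)) < p.2.+1%:R^-1.
pose J := {p | P p}; pose h (j : J) := (sval j).1.
pose leJ (j k : J) := Rplus_le (h j) (h k) /\ ((sval j).2 <= (sval k).2)%N.
have cofinal (r : R) n : exists j : J, r <= (h j)%:num /\ (n <= (sval j).2)%N.
  pose m := maxn (Num.truncn r).+1 n.
  have [|t mt ht] := rec_a m m.+1%:R^-1; first by rewrite invr_gt0.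
  have Ptm : P (t, m) by rewrite /P aE.
  exists (exist _ (t, m) Ptm); split; last by rewrite /= leq_maxr.
  rewrite /h /=; apply: le_trans mt; apply/ltW/(lt_le_trans (truncnS_gt _)).
  by rewrite ler_nat leq_maxl.
have dirJ : directed leJ.
  split.
  - by have [j _] := cofinal 0 0%N.
  - by move=> j; split => //; exact: lexx.
  - by move=> j k l [jk jk'] [kl kl']; split; [exact: le_trans jk kl | exact: leq_trans jk' kl'].
  - move=> j k; have [l []] := cofinal (Num.max (h j)%:num (h k)%:num)
      (maxn (sval j).2 (sval k).2).
    by rewrite ge_max geq_max => /andP[jl kl] /andP[jl' kl']; exists l.
exists J, leJ, h; split.
  split => //; first by move=> j k [].
  by move=> t; have [j [tj _]] := cofinal t%:num 0%N; exists j.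
have [_ leJxx leJtr leJdir] := dirJ.
have FJ : Filter (tails leJ).
  apply: filter_from_filter; first by have [j _] := cofinal 0 0%N; exists j.
  move=> j k _ _; have [l jl kl] := leJdir j k.
  by exists l => // m lm; split; apply: leJtr lm.
move=> x; apply/cvgrPdist_lt => _ /gt0_complexE[e e0 ->].
have [k xk] := xs_dense x (divr_gt0 e0 (ltr0Sn R 3)).
have [n hn] := invS_lt (divr_gt0 (exprn_gt0 2 e0) (ltr0Sn R 7)).
have [j [_ nj]] := cofinal 0 (maxn n k.+1).
exists j => // l [_ jl]; rewrite /= rnorm_lt rnormB.
apply: dist_scalar_lt xk _ => //.
have : (maxn n k.+1 <= (sval l).2)%N by exact: leq_trans jl.
rewrite geq_max => /andP[nl kl].
by apply: lt_trans (hn _ nl); apply: (svalP l).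
Qed.

Lemma dense_seq_approx (ys : seq H) e : 0 < e ->
  exists M, forall y, y \in ys -> exists2 m, (m < M)%N & rnorm (y - xs m) < e.
Proof.
move=> e0; elim: ys => [|y ys [M hM]]; first by exists 0%N.
have [m ym] := xs_dense y e0.
exists (maxn M m.+1) => z; rewrite inE => /predU1P[->|/hM[m' m'M zm']].
  by exists m => //; rewrite leq_max leqnn orbT.
by exists m' => //; rewrite leq_max m'M.
Qed.

(** Replace [x] and the finitely many [y] by members of the dense sequence; contractivity makes the
    replacement errors uniform in time, so one late recurrence time serves all. *)
Lemma recurrent0_small : (forall n, recurrent xs n 0 T) ->
  forall x (ys : seq H) (t0 e : R), 0 < e -> exists2 t : Rplus R, t0 <= t%:num &
    forall y, y \in ys -> rnorm (dot (T t x) y) < e.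
Proof.
move=> recT x ys t0 e e0.
pose B : R := 1 + \sum_(y <- ys) rnorm y.
have sum0 (s : seq H) : 0 <= \sum_(y <- s) rnorm y.
  by apply: sumr_ge0 => y _; exact: rnorm_ge0.
have B0 : 0 < B by rewrite ltr_wpDr.
have lB y : y \in ys -> rnorm y <= B.
  move=> yl; rewrite /B (big_rem y)//= addrCA lerDl.
  by rewrite addr_ge0// sum0.
have e3 : 0 < e / 3 by rewrite divr_gt0.
have [k xk] := xs_dense x (divr_gt0 e3 B0).
pose c : R := 1 + rnorm (xs k).
have c0 : 0 < c by rewrite ltr_wpDr// rnorm_ge0.
have [M hM] := dense_seq_approx ys (divr_gt0 e3 c0).
have [n hn] := invS_lt e3.
pose n' := maxn (maxn n k.+1) (maxn M (Num.truncn t0).+1).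
have [t nt ht] := recT n'.
exists t.
  apply: le_trans nt; apply/ltW/(lt_le_trans (truncnS_gt _)).
  by rewrite ler_nat /n' !leq_max leqnn !orbT.
move=> y yl; have [m mM ym] := hM y yl.
have kn : (k < n')%N by rewrite /n' !leq_max leqnn !orbT.
have mn : (m < n')%N by rewrite /n' !leq_max mM !orbT.
have := ht (Ordinal kn) (Ordinal mn); rewrite /= mul0r subr0 => h3.
have {}h3 : rnorm (dot (T t (xs k)) (xs m)) < e / 3.
  by apply: lt_trans h3 _; apply: hn; rewrite /n' !leq_max leqnn.
have -> : dot (T t x) y = dot (T t (x - xs k)) y + dot (T t (xs k)) (y - xs m)
    + dot (T t (xs k)) (xs m).
  by rewrite sg_sub dotBl dotBr; ring.
have h1 : rnorm (dot (T t (x - xs k)) y) < e / 3.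
  apply: le_lt_trans (cauchy_schwarz dot_norm _ _) _.
  apply: (@le_lt_trans _ _ (rnorm (x - xs k) * B)).
    by rewrite ler_pM ?rnorm_ge0 ?lB ?sg_rnorm.
  by rewrite -ltr_pdivlMr.
have h2 : rnorm (dot (T t (xs k)) (y - xs m)) < e / 3.
  apply: le_lt_trans (cauchy_schwarz dot_norm _ _) _.
  apply: (@le_lt_trans _ _ (c * rnorm (y - xs m))).
    rewrite ler_pM ?rnorm_ge0//; apply: le_trans (sg_rnorm _ _ _) _.
    by rewrite lerDr.
  by rewrite mulrC -ltr_pdivlMr.
apply: le_lt_trans (ler_rnormD _ _) _.
have := ler_rnormD (dot (T t (x - xs k)) y) (dot (T t (xs k)) (y - xs m)).
by move=> ?; lra.
Qed.

End Recurrence.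

(** * Density of sets of times *)

Section Density.
Variable R : realType.
Local Notation leb := (@lebesgue_measure R).
Local Open Scope ereal_scope.

Lemma measurable_shift (c : R) : measurable_fun [set: R] (fun s => s + c)%R.
Proof. exact: measurable_funD. Qed.

Lemma lebesgue_shift (c : R) (E : set R) : measurable E ->
  leb ((fun s => s + c)%R @^-1` E) = leb E.
Proof.
move=> mE.
rewrite -[LHS]/(pushforward leb (fun s => s + c : measurableTypeR R)%R E).
apply/esym/lebesgue_measure_unique => //=; first exact: measurable_shift.
move=> ? _ [[a b] _ <-] /=.
rewrite /pushforward (_ : _ @^-1` _ = `](a - c)%R, (b - c)%R]%classic); last first.
  by apply/seteqP; split => s /=; rewrite !in_itv /= ltrBlDr lerBrDr.
rewrite !lebesgue_measure_itv /= !lte_fin ltrD2r; case: ifP => // _.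
by rewrite -!EFinB; congr EFin; ring.
Qed.

Lemma leb_itv0 (t : R) : (0 <= t)%R -> leb `[0%R, t] = t%:E.
Proof.
move=> t0; rewrite lebesgue_measure_itv /= lte_fin; case: ltP => [_|t0'].
  by rewrite -EFinB subr0.
by congr EFin; apply/eqP; rewrite eq_le t0.
Qed.

Definition dmass (E : set R) (t : R) : R := fine (leb (E `&` `[0%R, t])).

Lemma leb_capE (E : set R) t : measurable E -> (0 <= t)%R ->
  leb (E `&` `[0%R, t]) = (dmass E t)%:E.
Proof.
move=> mE t0; rewrite /dmass fineK// ge0_fin_numE//.
apply: (@le_lt_trans _ _ (leb `[0%R, t])); last by rewrite leb_itv0// ltry.
by apply: le_measure; rewrite ?inE; [exact: measurableI|exact: measurable_itv|exact: subIsetr].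
Qed.

Lemma dmass_ge0 E t : (0 <= dmass E t)%R.
Proof. exact: fine_ge0. Qed.

Lemma le_dmass (E F : set R) t : measurable E -> measurable F -> (0 <= t)%R ->
  E `&` `[0%R, t] `<=` F -> (dmass E t <= dmass F t)%R.
Proof.
move=> mE mF t0 EF; rewrite -lee_fin -!leb_capE//; apply: le_measure.
- by rewrite inE; exact: measurableI.
- by rewrite inE; exact: measurableI.
- by move=> s [Es st]; split => //; exact: EF.
Qed.

Lemma dmassU (E F : set R) t : measurable E -> measurable F -> (0 <= t)%R ->
  (dmass (E `|` F) t <= dmass E t + dmass F t)%R.
Proof.
move=> mE mF t0; rewrite -lee_fin EFinD -!leb_capE//; last exact: measurableU.
by rewrite setIUl; apply: measureU2; exact: measurableI.
Qed.

Lemma dmass_compl (E : set R) t : measurable E -> (0 <= t)%R ->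
  (dmass (~` E) t = t - dmass E t)%R.
Proof.
move=> mE t0; apply: (addrI (dmass E t)); rewrite addrC [RHS]addrC subrK.
apply/EFin_inj; rewrite EFinD -!leb_capE//; last exact: measurableC.
rewrite -measureU//=; [|exact: measurableI (measurableC _) _|exact: measurableI|].
  by rewrite -setIUl setUC setUv setTI leb_itv0.
by rewrite setIACA setICl set0I.
Qed.

(** Up to time [c] the mass is at most [c]; the part of [E] in [[c, t]] is a translate of a part of
    the shifted set in [[0, t]]. *)
Lemma dmass_shift (E : set R) (c t : R) : measurable E -> (0 <= c)%R -> (0 <= t)%R ->
  (dmass E t <= c + dmass ((fun s => s + c)%R @^-1` E) t)%R.
Proof.
move=> mE c0 t0; have mS : measurable ((fun s => s + c)%R @^-1` E).
  by rewrite -[_ @^-1` _]setTI; exact: measurable_shift.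
rewrite -lee_fin EFinD -!leb_capE//.
have := lebesgue_shift c (measurableI _ _ mE (measurable_itv `[c, t])) => shE.
apply: (@le_trans _ _ (leb (`[0%R, c] `|` (E `&` `[c, t])))).
  apply: le_measure; rewrite ?inE.
  - exact: measurableI.
  - by apply: measurableU => //; exact: measurableI.
  - move=> s [Es]; rewrite /= !in_itv /= => /andP[s0 st].
    have [sc|/ltW sc] := leP s c; first by left; rewrite s0.
    by right; rewrite sc.
apply: le_trans (measureU2 _ _ _) _ => //; first exact: measurableI.
apply: leeD; first by rewrite -(leb_itv0 c0).
rewrite -[leLHS]shE; apply: le_measure; rewrite ?inE.
- rewrite -[_ @^-1` _]setTI; apply: measurable_shift => //.
  exact: measurableI.
- exact: measurableI.
- move=> s [/= Es]; rewrite !in_itv /= => /andP[cs sct]; split => //.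
  by apply/andP; split; lra.
Qed.

(** Integrate the pointwise bound on the sum of indicators over [[0, t]]. *)
Lemma sum_dmass_le (m : nat) (E : 'I_m -> set R) (C t : R) :
  (forall i, measurable (E i)) -> (0 <= t)%R -> (0 <= C)%R ->
  (forall s : R, (0 <= s)%R -> \sum_i \1_(E i) s <= C)%R ->
  (\sum_i dmass (E i) t <= C * t)%R.
Proof.
move=> mE t0 C0 hC; rewrite -lee_fin -sumEFin.
rewrite (eq_bigr (fun i => \int[leb]_(s in `[0%R, t]) (\1_(E i) s)%:E)); last first.
  by move=> i _; rewrite -leb_capE//; apply/esym/integral_indic; [exact: measurable_itv|exact: mE].
rewrite -ge0_integral_sum//; last first.
  by move=> i; apply/measurable_EFinP; apply: measurable_indic; exact: mE.
rewrite EFinM -(leb_itv0 t0) -integral_cst//.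
apply: ge0_le_integral => //.
- by move=> s _; apply: sume_ge0 => i _; rewrite lee_fin.
- apply: emeasurable_sum => i; apply/measurable_EFinP; apply: measurable_indic; exact: mE.
- move=> s; rewrite /= in_itv /= => /andP[s0 _].
  by rewrite sumEFin lee_fin hC.
Qed.

Local Close Scope ereal_scope.

Definition density_zero (E : set R) :=
  forall e : R, 0 < e -> exists M : R, forall t, 0 <= t -> M <= t -> dmass E t <= e * t.

(* Integrating the bounded overlap of the [m] translates of [E] over [0, t] bounds
   [m * leb (E `&` `[0, t])] by [C * t] up to a constant. *)
Lemma density_zero_overlap (E : set R) (C : R) : measurable E -> 0 <= C ->
  (forall m, exists2 tau : 'I_m -> R, forall i, 0 <= tau i &
     forall s : R, 0 <= s -> \sum_i \1_E (s + tau i) <= C) ->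
  density_zero E.
Proof.
(* With this [m], the term [C * t] uses at most half of [m * e * t]; the threshold [M] below lets
   the sum of the translations use the other half. *)
move=> mE C0 hE e e0; pose m := (Num.truncn (2 * C / e)).+1.
have mC : C <= m%:R * (e / 2).
  have : 2 * C / e <= m%:R by exact/ltW/truncnS_gt.
  by rewrite ler_pdivrMr//; lra.
have [tau tau0 htau] := hE m.
have m0 : 0 < m%:R :> R by [].
pose M := (\sum_i tau i) / (m%:R * (e / 2)).
exists M => t t0 Mt.
have shift_m i : measurable ((fun s => s + tau i) @^-1` E).
  by rewrite -[_ @^-1` _]setTI; exact: measurable_shift.
have h1 : m%:R * dmass E t <= \sum_i tau i + C * t.
  have := @sum_dmass_le m (fun i => (fun s => s + tau i) @^-1` E) C t shift_m t0 C0 htau.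
  move=> /(lerD (lexx (\sum_i tau i))); apply: le_trans.
  rewrite -big_split /= -[m in m%:R]card_ord mulr_natl -sumr_const.
  by apply: ler_sum => i _; exact: dmass_shift.
have h2 : \sum_i tau i <= m%:R * (e / 2) * t.
  by move: Mt; rewrite /M ler_pdivrMr ?mulr_gt0// mulrC.
have h3 : C * t <= m%:R * (e / 2) * t by rewrite ler_wpM2r.
rewrite -(ler_pM2l m0); lra.
Qed.

Lemma density_zero0 : density_zero set0.
Proof.
move=> e e0; exists 0 => t t0 _.
by rewrite /dmass set0I measure0 /= mulr_ge0// ltW.
Qed.

Lemma density_zeroU E F : measurable E -> measurable F ->
  density_zero E -> density_zero F -> density_zero (E `|` F).
Proof.
move=> mE mF zE zF e e0; have e2 : 0 < e / 2 by rewrite divr_gt0.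
have [M1 h1] := zE _ e2; have [M2 h2] := zF _ e2.
exists (Num.max M1 M2) => t t0; rewrite ge_max => /andP[t1 t2].
apply: le_trans (dmassU mE mF t0) _.
by have := h1 t t0 t1; have := h2 t t0 t2; lra.
Qed.

Lemma density_zero_bigU (m : nat) (E : nat -> set R) :
  (forall i, measurable (E i)) -> (forall i, density_zero (E i)) ->
  measurable (\big[setU/set0]_(i < m) E i) /\
  density_zero (\big[setU/set0]_(i < m) E i).
Proof.
move=> mE zE; split; first exact: bigsetU_measurable.
elim: m => [|m IH]; first by rewrite big_ord0; exact: density_zero0.
rewrite big_ord_recr /=; apply: density_zeroU => //.
exact: bigsetU_measurable.
Qed.

(* Koopman-von Neumann diagonalisation: remove from [0, +oo[ the set [E n] only
   beyond the time [T n] at which its density has dropped below [1/(n+1)]. *)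
Lemma density_one_diagonal (E : nat -> set R) :
  (forall n, measurable (E n)) -> (forall n, density_zero (E n)) ->
  (forall n m, (n <= m)%N -> E n `<=` E m) ->
  exists A : set R, [/\ measurable A, A `<=` `[0, +oo[, density_one A &
    forall n, exists M : R, forall s, A s -> M <= s -> ~ E n s].
Proof.
move=> mE zE ndE.
have /choice[M hM] : forall n, exists M : R, forall t, 0 <= t -> M <= t ->
    dmass (E n) t <= n.+1%:R^-1 * t.
  by move=> n; apply: zE; rewrite invr_gt0.
(* Because [T n] is at least [n], only finitely many [n] satisfy [T n <= t]. For the largest one,
   [N], monotonicity of [E] places all of [B] up to time [t] inside [E N]. *)
pose T n := Num.max (M n) n%:R.
pose B := \bigcup_n (E n `&` `[T n, +oo[).
have mB : measurable B.
  by apply: bigcup_measurable => n _; exact: measurableI.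
exists (`[0, +oo[ `&` ~` B); split.
- by apply: measurableI => //; exact: measurableC.
- exact: subIsetl.
- apply/cvgrPdist_lt => e e0; have [n0 hn0] := invS_lt e0.
  near=> t.
  have t0 : 0 < t by near: t; exact: nbhs_pinfty_gt.
  have Tt : T n0 <= t by near: t; apply: nbhs_pinfty_ge; exact: num_real.
  have t0' := ltW t0.
  have exN : exists n, T n <= t by exists n0.
  have boundN n : T n <= t -> (n <= Num.truncn t)%N.
    rewrite /T ge_max => /andP[_ nt].
    by rewrite truncn_ge_nat.
  pose N := ex_maxn exN boundN.
  have [NT maxN] : T N <= t /\ forall n, T n <= t -> (n <= N)%N.
    by rewrite /N; case: ex_maxnP.
  have BN : B `&` `[0, t] `<=` E N.
    move=> s [[n _ [Es]]]; rewrite /= !in_itv /= andbT => Ts /andP[_ st].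
    by apply: ndE Es; apply: maxN; exact: le_trans st.
  have dB : dmass B t <= N.+1%:R^-1 * t.
    apply: le_trans (le_dmass mB (mE N) t0' BN) _; apply: hM => //.
    by move: NT; rewrite /T ge_max => /andP[].
  have -> : `[0, +oo[ `&` ~` B `&` `[0, t] = ~` B `&` `[0, t].
    rewrite setIAC setIC; congr (_ `&` _); apply/seteqP; split => s /=.
      by case.
    by rewrite !in_itv /= => /andP[-> ->].
  rewrite -[fine _]/(dmass (~` B) t) dmass_compl// leb_itv0//=.
  have -> : 1 - (t - dmass B t) / t = dmass B t / t.
    by field; rewrite gt_eqF.
  rewrite ger0_norm ?divr_ge0 ?dmass_ge0//.
  apply: (@le_lt_trans _ _ N.+1%:R^-1); first by rewrite ler_pdivrMr.
  exact/hn0/maxN.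
- move=> n; exists (T n) => s [_ Bs] Ts Es; apply: Bs; exists n => //.
  by split => //; rewrite /= in_itv /= Ts.
Unshelve. all: by end_near.
Qed.

End Density.

(** * Almost weak stability *)

Section AlmostWeakStability.
Variables (R : realType) (H : completeNormedModType R[i]).
Variable dot : {dot H for Num.conj}.
Hypothesis dot_norm : forall x : H, dot x x = `|x| ^+ 2.

(* With [Q] the left-hand side and [u = \sum_i conj <S (v i), y> v i] one has
   [Q = <S u, y> <= |u| |y|], while [|u|^2 <= (b^2 + m delta) Q]. *)
Lemma almost_orthogonal_bessel (m : nat) (v : 'I_m -> H) (S : H -> H) (y : H)
    (b delta : R) : linear S -> (forall x, rnorm (S x) <= rnorm x) ->
  0 <= delta -> (forall i, rnorm (v i) <= b) ->
  (forall i j, i != j -> rnorm (dot (v i) (v j)) <= delta) ->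
  \sum_i rnorm (dot (S (v i)) y) ^+ 2 <= rnorm y ^+ 2 * (b ^+ 2 + m%:R * delta).
Proof.
move=> linS contrS delta0 vb vdelta.
pose a i := Num.conj (dot (S (v i)) y).
have aE i : dot (S (v i)) y = Num.conj (a i) by rewrite /a Num.Theory.conjCK.
have ra i : rnorm (dot (S (v i)) y) = rnorm (a i) by rewrite rnorm_conj.
clearbody a; pose u := \sum_i a i *: v i.
under eq_bigr do rewrite ra.
set Q := \sum_i _.
have Q0 : 0 <= Q by apply: sumr_ge0 => i _; exact: sqr_ge0.
have S0 : S 0 = 0 := linear_at0 linS.
have SD x x' : S (x + x') = S x + S x' by rewrite -[x in LHS]scale1r linS scale1r.
have Su : dot (S u) y = Q%:C.
  rewrite /u (big_morph S SD S0) dot_suml rmorph_sum; apply: eq_bigr => i _ /=.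
  by rewrite -[_ *: _]addr0 linS S0 addr0 dotZl -mul_conj aE.
have Qu : Q <= rnorm u * rnorm y.
  have := cauchy_schwarz dot_norm (S u) y; rewrite Su rnorm_real ger0_norm// => h.
  by apply: le_trans h _; rewrite ler_wpM2r ?rnorm_ge0.
have u2 : rnorm u ^+ 2 <= (b ^+ 2 + m%:R * delta) * Q.
  rewrite (rnorm_sqr dot_norm); apply: le_trans (ler_norm _) _.
  apply: le_trans (Re_le_rnorm _) _; rewrite /u dot_suml.
  apply: le_trans (ler_rnorm_sum _ _ _) _.
  (* The diagonal term gives [b ^+ 2]; the others are split by 2 |a_i| |a_j| <= |a_i|^2 + |a_j|^2.
     The right-hand sum includes [j = i] so that it is easy to evaluate. *)
  have E i : rnorm (dot (a i *: v i) (\sum_j a j *: v j)) <=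
      b ^+ 2 * rnorm (a i) ^+ 2 +
      \sum_j delta * ((rnorm (a i) ^+ 2 + rnorm (a j) ^+ 2) / 2).
    rewrite dot_sumr (bigD1 i)//=; apply: le_trans (ler_rnormD _ _) _.
    have ri := rnorm_ge0 (a i).
    apply: lerD.
      rewrite dotZl dotZr !rnormM rnorm_conj (dot_rnorm dot_norm) rnorm_real.
      rewrite ger0_norm ?sqr_ge0// mulrA -expr2 mulrC ler_wpM2r ?sqr_ge0//.
      by rewrite ler_sqr ?nnegrE ?rnorm_ge0// (le_trans _ (vb i)) ?rnorm_ge0.
    apply: le_trans (ler_rnorm_sum _ _ _) _.
    rewrite [leRHS](bigD1 i)//= -[leLHS]add0r lerD//.
      by rewrite mulr_ge0// divr_ge0// addr_ge0// sqr_ge0.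
    apply: ler_sum => j ji; rewrite dotZl dotZr !rnormM rnorm_conj.
    have rj := rnorm_ge0 (a j); have d0 := rnorm_ge0 (dot (v i) (v j)).
    have dd : rnorm (dot (v i) (v j)) <= delta by apply: vdelta; rewrite eq_sym.
    rewrite mulrA mulrC ler_pM ?mulr_ge0//.
    have := sqr_ge0 (rnorm (a i) - rnorm (a j)); rewrite sqrrB mulr2n.
    by move=> ?; lra.
  apply: le_trans (ler_sum _ (fun i _ => E i)) _.
  rewrite big_split /= -mulr_sumr -/Q mulrDl lerD2l.
  under eq_bigr do rewrite -mulr_sumr -mulr_suml big_split /= sumr_const card_ord.
  rewrite -mulr_sumr -mulr_suml big_split /= sumrMnl sumr_const card_ord.
  rewrite -/Q -[Q *+ m]mulr_natl.
  by rewrite (_ : delta * _ = m%:R * delta * Q)//; field.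
(* A factor [Q] will be cancelled, so [Q = 0] is treated apart. *)
have [->|Qn0] := eqVneq Q 0.
  rewrite mulr_ge0 ?sqr_ge0// addr_ge0 ?sqr_ge0 ?mulr_ge0//.
have Qp : 0 < Q by rewrite lt_neqAle eq_sym Qn0.
rewrite -(ler_pM2r Qp); apply: (@le_trans _ _ ((rnorm u * rnorm y) ^+ 2)).
  by rewrite -expr2 ler_sqr ?nnegrE ?mulr_ge0 ?rnorm_ge0.
by rewrite exprMn [leLHS]mulrC -[leRHS]mulrA ler_wpM2l ?sqr_ge0.
Qed.

Variable T : contractive_c0_semigroup H.

Definition large_coef (x y : H) (e : R) : set R :=
  `[0, +oo[ `&` (fun s => rnorm (dot (T (rp s) x) y)) @^-1` `[e, +oo[.

Lemma measurable_large_coef x y e : measurable (large_coef x y e).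
Proof.
apply: measurableI => //; rewrite -[_ @^-1` _]setTI.
apply: continuous_measurable_fun => // s; apply/cvgrPdist_lt => r r0.
have y0 : 0 < rnorm y + 1 by rewrite ltr_wpDl// rnorm_ge0.
have ry0 : 0 < r / (rnorm y + 1) by rewrite divr_gt0.
have /cvgrPdist_lt/(_ (r / (rnorm y + 1))%:C) := @continuous_sg_rp R H T x s.
rewrite ltcR => /(_ ry0); apply: filterS => s'; rewrite rnorm_lt => h.
apply: (@le_lt_trans _ _ (rnorm (T (rp s) x - T (rp s') x) * rnorm y)).
  apply: le_trans _ (cauchy_schwarz dot_norm _ _); rewrite dotBl.
  set p := dot _ _; set q := dot _ _.
  rewrite ler_norml; apply/andP; split.
    have := ler_rnormD (q - p) p; rewrite subrK rnormB; lra.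
  by have := ler_rnormD (p - q) q; rewrite subrK; lra.
apply: (@le_lt_trans _ _ (rnorm (T (rp s) x - T (rp s') x) * (rnorm y + 1))).
  by rewrite ler_wpM2l ?rnorm_ge0// lerDl.
by rewrite -ltr_pdivlMr.
Qed.

Hypothesis T_recurrent : forall x (ys : seq H) (t0 e : R), 0 < e ->
  exists2 t : Rplus R, t0 <= t%:num &
    forall y, y \in ys -> rnorm (dot (T t x) y) < e.

(** Choose the times one after another, each making [T t x] weakly small against the finitely many
    orbit vectors already chosen. *)
Lemma almost_orthogonal_orbit x (delta : R) m : 0 < delta ->
  exists tau : 'I_m -> Rplus R, forall i j, i != j ->
    rnorm (dot (T (tau i) x) (T (tau j) x)) <= delta.
Proof.
move=> delta0.
have [ts tsm hts] : exists2 ts : seq (Rplus R), size ts = m &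
    pairwise (fun s t => rnorm (dot (T t x) (T s x)) <= delta) ts.
  elim: m => [|m [ts tsm hts]]; first by exists [::].
  have [t _ ht] := T_recurrent x [seq T s x | s <- ts] 0 delta0.
  exists (rcons ts t); first by rewrite size_rcons tsm.
  rewrite pairwise_rcons hts andbT; apply/allP => s sts.
  by apply/ltW/ht/map_f.
exists (fun i => nth (rp 0) ts i) => i j ij.
have sym (k l : 'I_m) : (k < l)%N ->
    rnorm (dot (T (nth (rp 0) ts l) x) (T (nth (rp 0) ts k) x)) <= delta.
  move=> kl; have /(pairwiseP (rp 0)) := hts; apply => //.
    by rewrite inE tsm.
  by rewrite inE tsm.
have [/sym|/sym|/val_inj/eqP] := ltngtP i j => //; last by rewrite (negbTE ij).
by rewrite (dotC _ _ (T _ x)) rnorm_conj.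
Qed.

(** Every translate containing [s] contributes at least [e ^+ 2] to the sum of
    [almost_orthogonal_bessel]. The tolerance [1 / (m + 1)] keeps [m * delta] below 1, so the
    overlap bound [C] does not depend on [m]. *)
Lemma large_coef_density_zero x y e : 0 < e -> density_zero (large_coef x y e).
Proof.
move=> e0; pose C := rnorm y ^+ 2 * (rnorm x ^+ 2 + 1) / e ^+ 2.
have C0 : 0 <= C.
  by rewrite divr_ge0 ?sqr_ge0// mulr_ge0 ?sqr_ge0// addr_ge0 ?sqr_ge0.
apply: (density_zero_overlap (measurable_large_coef x y e) C0) => m.
have d0 : 0 < m.+1%:R^-1 :> R by rewrite invr_gt0.
have [tau htau] := almost_orthogonal_orbit x m d0.
exists (fun i => (tau i)%:num) => // s s0.
have := @almost_orthogonal_bessel m (fun i => T (tau i) x) (T (rp s)) y (rnorm x)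
  m.+1%:R^-1 (sg_linear T _) (sg_rnorm T _) (ltW d0).
move=> /(_ (fun i => sg_rnorm T (tau i) x) htau) bessel.
have e2 : 0 < e ^+ 2 by rewrite exprn_gt0.
rewrite /C ler_pdivlMr//; apply: (@le_trans _ _
    (\sum_i rnorm (dot (T (rp s) (T (tau i) x)) y) ^+ 2)).
  rewrite mulr_suml; apply: ler_sum => i _; rewrite indicE.
  case: (boolP (_ \in _)) => [|_]; last by rewrite mul0r sqr_ge0.
  rewrite inE => -[_ /=]; rewrite in_itv /= andbT sg_rpD// rpK => h.
  by rewrite mul1r ler_sqr ?nnegrE ?rnorm_ge0 ?(ltW e0).
apply: le_trans bessel _; rewrite ler_wpM2l ?sqr_ge0// lerD2l.
by rewrite ler_pdivrMr// mul1r ler_nat.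
Qed.

(** The exceptional sets of the first [n] dense vectors at level [1 / (n + 1)] increase with [n] and
    have density zero. Along the set [A] obtained by diagonalisation all coefficients of dense
    vectors tend to 0, and contractivity extends this to all vectors. *)
Lemma recurrent_almost_weakly_stable (xs : nat -> H) :
  (forall x e, 0 < e -> exists n, rnorm (x - xs n) < e) ->
  almost_weakly_stable dot T.
Proof.
move=> xs_dense.
pose E0 (n k m : nat) := large_coef (xs k) (xs m) n.+1%:R^-1.
pose E n := \big[setU/set0]_(k < n) \big[setU/set0]_(m < n) E0 n k m.
have e_gt0 n : 0 < n.+1%:R^-1 :> R by rewrite invr_gt0.
have E1 n k : measurable (\big[setU/set0]_(m < n) E0 n k m) /\
    density_zero (\big[setU/set0]_(m < n) E0 n k m).
  apply: density_zero_bigU => m; first exact: measurable_large_coef.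
  exact: large_coef_density_zero.
have E2 n : measurable (E n) /\ density_zero (E n).
  apply: (@density_zero_bigU R n (fun k => \big[setU/set0]_(m < n) E0 n k m)) => k.
    by case: (E1 n k).
  by case: (E1 n k).
have memE n s : E n s <-> exists k m, [/\ (k < n)%N, (m < n)%N & E0 n k m s].
  rewrite /E -(bigcup_mkord n (fun k => \big[setU/set0]_(m < n) E0 n k m)); split.
    move=> [k /= kn]; rewrite -(bigcup_mkord n (E0 n k)) => -[m /= mn h].
    by exists k, m.
  move=> [k [m [kn mn h]]]; exists k => //=.
  by rewrite -(bigcup_mkord n (E0 n k)); exists m.
have ndE n m : (n <= m)%N -> E n `<=` E m.
  move=> nm s /memE[k [l [kn ln [s0 h]]]]; apply/memE; exists k, l; split.
  - exact: leq_trans nm.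
  - exact: leq_trans nm.
  - split => //; move: h; rewrite /= !in_itv /= !andbT; apply: le_trans.
    by rewrite lef_pV2 ?posrE// ler_nat ltnS.
have [A [mA A0 dA hA]] := density_one_diagonal (fun n => (E2 n).1)
  (fun n => (E2 n).2) ndE.
exists A; split => // x y; rewrite dot0l.
have Ftails : Filter (tails (@Rplus_le R)).
  apply: filter_from_filter; first by exists (rp 0).
  move=> i j _ _; exists (rp (Num.max i%:num j%:num)) => // k.
  rewrite /Rplus_le /= ger0_norm; last by rewrite le_max ge0.
  by rewrite ge_max => /andP[].
have Fwithin : Filter (within [set t : Rplus R | A t%:num] (tails (@Rplus_le R))).
  exact: within_filter.
apply/cvgrPdist_lt => _ /gt0_complexE[e e0 ->].
have e3 : 0 < e / 3 by rewrite divr_gt0.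
have y0 : 0 < rnorm y + 1 by rewrite ltr_wpDl// rnorm_ge0.
have [k xk] := xs_dense x _ (divr_gt0 e3 y0).
have k0 : 0 < rnorm (xs k) + 1 by rewrite ltr_wpDl// rnorm_ge0.
have [m ym] := xs_dense y _ (divr_gt0 e3 k0).
have [n hn] := invS_lt e3.
pose n' := maxn n (maxn k.+1 m.+1).
have [M hM] := hA n'.
rewrite near_withinE; exists (rp M) => // t /= Mt At.
have {}Mt : M <= t%:num by apply: le_trans Mt; exact: ler_norm.
have h3 : rnorm (dot (T t (xs k)) (xs m)) < e / 3.
  apply: lt_trans (hn n' (leq_maxl _ _)); rewrite ltNge; apply/negP => h.
  apply: (hM _ At Mt); apply/memE; exists k, m; split.
  - by rewrite /n' !leq_max leqnn !orbT.
  - by rewrite /n' !leq_max leqnn !orbT.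
  - by split; rewrite /= in_itv /= ?andbT ?ge0// rpK.
rewrite sub0r normrN rnorm_lt.
have -> : dot (T t x) y = dot (T t (x - xs k)) y + dot (T t (xs k)) (y - xs m)
    + dot (T t (xs k)) (xs m).
  by rewrite sg_sub dotBl dotBr; ring.
have h1 : rnorm (dot (T t (x - xs k)) y) < e / 3.
  apply: le_lt_trans (cauchy_schwarz dot_norm _ _) _.
  apply: (@le_lt_trans _ _ (rnorm (x - xs k) * (rnorm y + 1))).
    by rewrite ler_pM ?rnorm_ge0 ?sg_rnorm// lerDl.
  by rewrite -ltr_pdivlMr.
have h2 : rnorm (dot (T t (xs k)) (y - xs m)) < e / 3.
  apply: le_lt_trans (cauchy_schwarz dot_norm _ _) _.
  apply: (@le_lt_trans _ _ ((rnorm (xs k) + 1) * rnorm (y - xs m))).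
    rewrite ler_pM ?rnorm_ge0//; apply: le_trans (sg_rnorm _ _ _) _.
    by rewrite lerDl.
  by rewrite mulrC -ltr_pdivlMr.
apply: le_lt_trans (ler_rnormD _ _) _.
have := ler_rnormD (dot (T t (x - xs k)) y) (dot (T t (xs k)) (y - xs m)).
by move=> ?; lra.
Qed.

End AlmostWeakStability.

Theorem theorem1p3 (R : realType) (H : completeNormedModType R[i])
    (dot : {dot H for Num.conj})
    (dot_norm : forall x : H, dot x x = `|x| ^+ 2)
    (separable_H : separable H)
    (infinite_dimensional_H : infinite_dimensional H) :
  residual [set T : Cs dot |
    almost_weakly_stable dot T /\ unimodular_scalar_limits T].
Proof.
have [xs xs_dense] := separable_seq separable_H.
(* [Some q] uses equal phases, with half sum [ei (ratr q)]; [None] uses the phases 0 and pi, with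
   half sum 0. *)
pose angle (q : option rat) (b : bool) : R :=
  if q is Some q then ratr q else if b then 0 else pi.
(* The countably many conditions are enumerated by [pickle]; a number that codes nothing gets the
   whole space, which is open and dense. *)
pose U p := if unpickle p is Some (n, q)
  then recurrent xs n (2^-1 * (ei (angle q true) + ei (angle q false)))
  else [set: Cs dot].
have U_ei T n q : (\bigcap_p U p) T -> recurrent xs n (ei (ratr q)) T.
  move=> /(_ (pickle (n, Some q)) I); rewrite /U pickleK /=.
  by rewrite (_ : 2^-1 * _ = ei (ratr q))//; field.
have U_0 T n : (\bigcap_p U p) T -> recurrent xs n 0 T.
  move=> /(_ (pickle (n, None : option rat)) I); rewrite /U pickleK /=.
  rewrite ei0 (_ : ei pi = -1) ?subrr ?mulr0//.
  by rewrite /ei cospi sinpi; apply/eqP; rewrite eq_complex /= oppr0 !eqxx.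
exists U => [p|T UT].
  rewrite /U; case: unpickle => [[n q]|]; last first.
    by split; [exact: openT|move=> O O0 _; rewrite setIT].
  by split; [exact: recurrent_open | exact: recurrent_dense].
split.
  apply: (recurrent_almost_weakly_stable dot_norm _ xs_dense) => x ys t0 e.
  apply: (recurrent0_small dot_norm xs_dense) => n; exact: U_0.
by apply: (scalar_limits dot_norm xs_dense) => n q; exact: U_ei.
Qed.
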